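(* Let $G$ be an arbitrary (finite) connected multigraph and let $q=p^d$ with $p$ an odd prime and $d\in\mathbb N$, $d\ge 1$. For each $\alpha\in(\mathbb F_q^* )^{E(G)}$ let $W^*=W^*(\alpha,G)$ be any nonempty subset $W\subseteq V(G)$ of minimum cardinality with $s(\alpha,G/W)\neq 0$, and let $r^*(G,\alpha)=|V(G)|-|W^*|$. Then $$ F_G(q)=\sum_{\alpha\in(\mathbb F_q^* )^{E(G)}}\eta\bigl(s(\alpha,G/W^* )\bigr)\left[\frac{g(q)}{q}\right]^{r^*(G,\alpha)} . $$
   Context: $\mathbb F_q$ is the finite field with $q$ elements and $\mathbb F_q^*$ its set of nonzero elements. Flow polynomial: fix an arbitrary orientation of the edges of $G$, each edge $e$ going from $i(e)$ to $f(e)$, and let $\varepsilon_{ve}=-1$ if $v=i(e)$, $\varepsilon_{ve}=1$ if $v=f(e)$, $\varepsilon_{ve}=0$ if $e$ is not incident to $v$ (for a loop $e$ put $\varepsilon_{ve}=0$ for all $v$). For an abelian group $A_q$ of order $q$ (here the additive group of $\mathbb F_q$ may be taken), $F_G(q)$ is the number of nowhere-zero flows, i.e. of families $(k_e)_{e\in E(G)}$ of nonzero elements of $A_q$ such that $\sum_{e\in E(G)}\varepsilon_{ve}k_e=0$ for every $v\in V(G)$. This number is independent of the orientation and of the choice of the group of order $q$. $\eta$ is the quadratic character of $\mathbb F_q$: $\eta(0)=0$, and for $x\ne0$, $\eta(x)=1$ if $x$ is a square in $\mathbb F_q$ and $\eta(x)=-1$ otherwise. $g(q)$ is the quadratic Gaussian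 sum of $\mathbb F_q$: $g(q)=(-1)^{d-1}\sqrt q$ if $p\equiv 1 \pmod 4$ and $g(q)=(-1)^{d-1}i^d\sqrt q$ if $p\equiv 3\pmod 4$, where $i$ is the imaginary unit. For nonempty $W\subseteq V(G)$, $G/W$ is the multigraph obtained from $G$ by identifying all vertices of $W$ to a single vertex and deleting all edges with both endpoints in $W$; all other edges are kept (parallel edges included), with the same weights $\alpha_e$ as in $G$. For a connected multigraph $H$ with edge weights $\alpha_e$, $s(\alpha,H)=\sum_{T\in\tau(H)}\prod_{e\in E(T)}\alpha_e\in\mathbb F_q$, where $\tau(H)$ is the set of spanning trees of $H$; if $H$ has a single vertex, $s(\alpha,H)=1$. *)

(* Defs.v *)
From HB Require Import structures.
From mathcomp Require Import all_boot all_order all_algebra.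
Set Implicit Arguments.
Unset Strict Implicit.
Unset Printing Implicit Defensive.
Import Order.TTheory GRing.Theory Num.Theory.
Local Open Scope ring_scope.

(* Finite multigraphs, with loops and parallel edges, each carrying an        *)
(* orientation: the edge e goes from src e to tgt e. Only the incidence       *)
(* coefficients depend on the orientation; a statement about every multigraph *)
(* is a statement about every orientation.                                    *)
Record multigraph : Type := Multigraph {
  vertex : finType;
  edge : finType;
  src : edge -> vertex;
  tgt : edge -> vertex
}.

Definition joins (G : multigraph) (e : edge G) (u v : vertex G) : bool :=
  ((src e == u) && (tgt e == v)) || ((src e == v) && (tgt e == u)).

Definition adjacent (G : multigraph) (T : {set edge G}) : rel (vertex G) :=
  fun u v => [exists e in T, joins e u v].

Definition spans_connected (G : multigraph) (T : {set edge G}) : bool :=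
  (0 < #|vertex G|)%N && [forall u, forall v, connect (adjacent T) u v].

Definition connected_graph (G : multigraph) : bool :=
  spans_connected [set: edge G].

(* The cycle v_0, e_0, v_1, ..., v_(k-1), e_(k-1), v_0 is represented by the  *)
(* sequence of the pairs (v_i, e_i): a loop is a cycle with k = 1, a pair of  *)
(* parallel edges one with k = 2.                                             *)
Definition graph_cycle (G : multigraph)
    (c : seq (vertex G * edge G)) : bool :=
  [&& c != [::],
      cycle (fun x y => joins x.2 x.1 y.1) c,
      uniq (unzip1 c)
    & uniq (unzip2 c)].

(* The bound on k makes the predicate boolean and loses nothing, the vertices *)
(* of a cycle being distinct: see acyclicP.                                   *)
Definition acyclic (G : multigraph) (T : {set edge G}) : bool :=
  [forall k : 'I_(#|vertex G|).+1,
   forall c : k.-tuple (vertex G * edge G),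
     graph_cycle c ==> ~~ all (fun e => e \in T) (unzip2 c)].

Lemma acyclicP (G : multigraph) (T : {set edge G}) :
  reflect (forall c : seq (vertex G * edge G),
             graph_cycle c -> ~ {subset unzip2 c <= T})
          (acyclic T).
Proof.
apply: (iffP forallP) => [acT c cyc sub | acT k].
  have szc : (size c < #|vertex G|.+1)%N.
    case/and4P: cyc => _ _ /card_uniqP cardc _.
    by rewrite ltnS -(size_map fst) -/(unzip1 c) -cardc max_card.
  have /forallP/(_ (in_tuple c)) := acT (Ordinal szc).
  by rewrite /= cyc /= => /negP; apply; apply/allP.
by apply/forallP => c; apply/implyP => /acT sub; apply/negP => /allP.
Qed.

Definition spanning_tree (G : multigraph) (T : {set edge G}) : bool :=
  spans_connected T && acyclic T.

Definition tree_sum (R : comNzRingType) (H : multigraph)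
    (alpha : edge H -> R) : R :=
  \sum_(T : {set edge H} | spanning_tree T) \prod_(e in T) alpha e.

(* The vertex None of G / W is the class of W, for W nonempty; insub maps the *)
(* vertices of W to None.                                                     *)
Definition identify (G : multigraph) (W : {set vertex G}) : multigraph :=
  @Multigraph (option {v : vertex G | v \notin W})
    {e : edge G | ~~ ((src e \in W) && (tgt e \in W))}
    (fun e => insub (src (val e)))
    (fun e => insub (tgt (val e))).

Definition identify_tree_sum (R : comNzRingType) (G : multigraph)
    (alpha : edge G -> R) (W : {set vertex G}) : R :=
  @tree_sum R (identify W) (fun e => alpha (val e)).

Definition is_Wstar (R : comNzRingType) (G : multigraph)
    (alpha : edge G -> R) (W : {set vertex G}) : Prop :=
  [/\ W != set0,
      identify_tree_sum alpha W != 0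
    & forall W' : {set vertex G},
        W' != set0 -> identify_tree_sum alpha W' != 0 -> (#|W| <= #|W'|)%N].

Definition incidence (G : multigraph) (v : vertex G) (e : edge G) : int :=
  if src e == tgt e then 0
  else if v == src e then -1
  else if v == tgt e then 1
  else 0.

Definition nowhere_zero (A : nmodType) (E : finType) (k : {ffun E -> A}) : bool :=
  [forall e, k e != 0].

Definition is_flow (A : zmodType) (G : multigraph)
    (k : {ffun edge G -> A}) : bool :=
  [forall v : vertex G, \sum_(e : edge G) k e *~ incidence v e == 0].

Definition flow_number (A : finZmodType) (G : multigraph) : nat :=
  #|[set k : {ffun edge G -> A} | nowhere_zero k && is_flow k]|.

Definition quadratic_char (F : finFieldType) (x : F) : int :=
  if x == 0 then 0
  else if [exists y : F, x == y ^+ 2] then 1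
  else -1.

(* The closed form of the quadratic Gauss sum of the field with p ^ d         *)
(* elements, p an odd prime and d >= 1; the last branch is p = 3 mod 4.       *)
Definition gauss_sum (C : numClosedFieldType) (p d : nat) : C :=
  if (p %% 4 == 1)%N then (-1) ^+ d.-1 * sqrtC (p ^ d)%:R
  else (-1) ^+ d.-1 * 'i ^+ d * sqrtC (p ^ d)%:R.

(* Main.v *)
(* Both sides are evaluated by counting zeros. Writing [c] for 1 if c = 0 and *)
(* 0 otherwise, for nowhere-zero k the sum of q [<k, dx>] - 1 over the        *)
(* potentials x, where dx is the vector of potential differences along the    *)
(* edges, is q^|V| (q - 1) if k is a flow and 0 if not. Substituting k_e =    *)
(* alpha_e (dx)_e on the edges where (dx)_e <> 0 turns <k, dx> into the       *)
(* quadratic form of the weighted Laplacian L_alpha, so F_G(q) is determined  *)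
(* by the numbers of zeros of these forms. A form of odd rank contributes 0.  *)
(* A form of even rank r = 2m contributes eta((-1)^m D) q^-m, up to the       *)
(* factor q^|V| (q - 1), where D is any nonzero principal minor of order r.   *)
(* The matrix-tree theorem identifies the principal minor outside W with      *)
(* s(alpha, G/W), and the largest nonzero principal minors of a symmetric     *)
(* matrix have the order of its rank, whence r = |V| - |W*|. As g(q)^2 =      *)
(* eta(-1) q, these are the terms of even r*. The terms of odd r* cancel:     *)
(* multiplying alpha by a nonsquare keeps the rank and changes the sign. In   *)
(* particular the sign of the Gauss sum is not used.                          *)

(* The plan above is carried by the following results. [flow_number_excess] writes the flow number
   as a sum of [zero_excess] over the values of the Laplacian forms. [sum_zero_excess_qform_even]
   and [sum_zero_excess_qform_odd] evaluate the inner sum for any symmetric matrix: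
   [sym_rank_factor] compresses the matrix to an invertible principal block, [diagonalize] makes
   this block diagonal, and [binary_excessE] removes the coefficients in pairs. [det_laplacian] is
   the matrix-tree theorem for G/W, proved by deletion and contraction, and [Wstar_rank] translates
   the minimality of W* into the maximality of a nonzero principal minor. [sum_Wstar_odd] cancels
   the terms of odd exponent. The counting is done in [int]; the field [C] enters only in the final
   comparison. *)
Require Import Defs.
From HB Require Import structures.
From mathcomp Require Import all_boot all_order all_algebra.
From mathcomp Require Import cyclic finfield.
From mathcomp Require Import zify ring.
Set Implicit Arguments.
Unset Strict Implicit.
Unset Printing Implicit Defensive.
Import Order.TTheory GRing.Theory Num.Theory.
Local Open Scope ring_scope.

(** * The quadratic character *)

(** A generator z turns nonzero elements into powers of z, and statements on [quadratic_char] into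
    statements on the parity of exponents. *)
Lemma finField_prim_root (F : finFieldType) :
  exists z : F, #|F|.-1.-primitive_root z.
Proof.
have q_gt1 := finNzRing_gt1 F.
suff /hasP[z _ z_prim] :
  has #|F|.-1.-primitive_root (enum [pred x : F | x != 0]) by exists z.
apply: has_prim_root; rewrite ?enum_uniq //; first by rewrite -subn1 subn_gt0.
- apply/allP => x; rewrite mem_enum inE => x_neq0.
  by rewrite unity_rootE -(inj_eq (mulfI x_neq0)) mulr1 -exprS
     (ltn_predK q_gt1) expf_card.
by rewrite -cardE (cardC1 (0 : F)).
Qed.

Lemma prim_root_logP (F : finFieldType) (z x : F) :
  #|F|.-1.-primitive_root z -> x != 0 -> exists i, x = z ^+ i.
Proof.
move=> z_prim x_neq0; have q_gt1 := finNzRing_gt1 F.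
have x1 : x ^+ #|F|.-1 = 1.
  by apply: (mulfI x_neq0); rewrite mulr1 -exprS (ltn_predK q_gt1) expf_card.
by have [i ->] := prim_rootP z_prim x1; exists i.
Qed.

Lemma prim_root_neq0 (F : finFieldType) (z : F) :
  #|F|.-1.-primitive_root z -> z != 0.
Proof.
move/(fun h => prim_root_eq0 h) => ->.
by have := finNzRing_gt1 F; case: #|F| => [|[]].
Qed.

Lemma odd_pred_card (F : finFieldType) : odd #|F| -> odd #|F|.-1 = false.
Proof. by have := finNzRing_gt1 F; case: #|F| => // n _ /= /negbTE. Qed.

Lemma odd_card_natr2_neq0 (F : finFieldType) : odd #|F| -> 2 != 0 :> F.
Proof.
move=> oddF; have [z z_prim] := finField_prim_root F.
by apply: (prim_root_dvd_eq0 z_prim); rewrite dvdn2 odd_pred_card.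
Qed.

Lemma quadratic_char0 (F : finFieldType) : quadratic_char (0 : F) = 0.
Proof. by rewrite /quadratic_char eqxx. Qed.

(** Exponents of z matter modulo q - 1, which is even, so their parity is well defined and the
    squares are the even powers. *)
Lemma quadratic_char_prim_root (F : finFieldType) (z : F) i :
  odd #|F| -> #|F|.-1.-primitive_root z -> quadratic_char (z ^+ i) = (-1) ^+ i.
Proof.
move=> oddF z_prim; have z_neq0 := prim_root_neq0 z_prim.
rewrite /quadratic_char expf_eq0 (negPf z_neq0) andbF -signr_odd.
case: existsP => [[y /eqP def_y] | nsq]; case: (boolP (odd i)) => // odd_i.
- have y_neq0 : y != 0.
    by apply: contraTneq odd_i => y0; move/eqP: def_y;
       rewrite y0 expr0n /= expf_eq0 (negPf z_neq0) andbF.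
  have [j def_z] := prim_root_logP z_prim y_neq0.
  move/eqP: def_y; rewrite def_z -exprM (eq_prim_root_expr z_prim) => /eqP
    eq_ij.
  have dvd2 : (2 %| #|F|.-1)%N by rewrite dvdn2 odd_pred_card.
  have := congr1 odd (congr1 (modn^~ 2) eq_ij); rewrite !(modn_dvdm _ dvd2).
  by rewrite !modn2 oddM andbF odd_i.
case: nsq; exists (z ^+ i./2).
by rewrite -exprM muln2 -[X in z ^+ X == _]odd_double_half (negPf odd_i).
Qed.

Lemma quadratic_charM (F : finFieldType) (x y : F) : odd #|F| ->
  quadratic_char (x * y) = quadratic_char x * quadratic_char y.
Proof.
move=> oddF; have [z z_prim] := finField_prim_root F.
have [->|/(prim_root_logP z_prim)[i ->]] := eqVneq x 0.
  by rewrite mul0r quadratic_char0 mul0r.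
have [->|/(prim_root_logP z_prim)[j ->]] := eqVneq y 0.
  by rewrite mulr0 quadratic_char0 mulr0.
by rewrite -exprD !quadratic_char_prim_root // exprD.
Qed.

Lemma quadratic_charX (F : finFieldType) (x : F) n : odd #|F| ->
  quadratic_char (x ^+ n) = quadratic_char x ^+ n.
Proof.
move=> oddF; elim: n => [|n IHn]; last by rewrite !exprS quadratic_charM // IHn.
have [z z_prim] := finField_prim_root F.
by have := quadratic_char_prim_root 0 oddF z_prim; rewrite !expr0.
Qed.

Lemma quadratic_char_sqr (F : finFieldType) (x : F) : odd #|F| -> x != 0 ->
  quadratic_char (x ^+ 2) = 1.
Proof.
move=> oddF x_neq0; have [z z_prim] := finField_prim_root F.
have [i ->] := prim_root_logP z_prim x_neq0.
by rewrite -exprM quadratic_char_prim_root // mulnC exprM sqrrN expr1n.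
Qed.

Lemma quadratic_char1P (F : finFieldType) (x : F) :
  quadratic_char x = 1 -> exists2 y, y != 0 & x = y ^+ 2.
Proof.
rewrite /quadratic_char; case: (eqVneq x 0) => // x_neq0.
case: existsP => // -[y /eqP def_x] _; exists y => //.
by apply: contraNneq x_neq0 => y0; rewrite def_x y0 expr0n.
Qed.

Lemma quadratic_char_sign (F : finFieldType) (x : F) : x != 0 ->
  quadratic_char x = 1 \/ quadratic_char x = -1.
Proof. by rewrite /quadratic_char => /negPf->; case: ifP; [left | right]. Qed.

Lemma nonsquare_exists (F : finFieldType) : odd #|F| ->
  exists x : F, quadratic_char x = -1.
Proof.
move=> oddF; have [z z_prim] := finField_prim_root F; exists z.
by have := quadratic_char_prim_root 1 oddF z_prim; rewrite !expr1.
Qed.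

(** The power of z of exponent (q - 1)/2 squares to 1 and is not 1, by the order of z; hence it is
    -1. *)
Lemma quadratic_charN1 (F : finFieldType) : odd #|F| ->
  quadratic_char (-1 : F) = (-1) ^+ #|F|.-1./2.
Proof.
move=> oddF; have [z z_prim] := finField_prim_root F.
have half2 : (#|F|.-1./2 * 2 = #|F|.-1)%N.
  by rewrite muln2 -[RHS]odd_double_half odd_pred_card.
suff -> : -1 = z ^+ #|F|.-1./2 by rewrite quadratic_char_prim_root.
apply/esym/eqP; have : (z ^+ #|F|.-1./2) ^+ 2 == 1 ^+ 2.
  by rewrite -exprM half2 expr1n (prim_expr_order z_prim).
rewrite eqf_sqr => /orP[|//]; rewrite -(prim_order_dvd z_prim) => /dvdn_leq.
have := prim_order_gt0 z_prim; move: half2; lia.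
Qed.

(** This is the sum at t of the q - 1 nontrivial additive characters of F, written as an integer so
    that no roots of unity appear. *)
Definition zero_excess (F : finFieldType) (t : F) : int :=
  #|F|%:Z * (t == 0) - 1.

Lemma zero_excess0 (F : finFieldType) : zero_excess (0 : F) = #|F|%:Z - 1.
Proof. by rewrite /zero_excess eqxx mulr1. Qed.

Lemma zero_excessM (F : finFieldType) (a t : F) :
  a != 0 -> zero_excess (a * t) = zero_excess t.
Proof. by move=> a_neq0; rewrite /zero_excess mulf_eq0 (negPf a_neq0). Qed.

Lemma sum_zero_excess (F : finFieldType) : \sum_(t : F) zero_excess t = 0.
Proof.
rewrite /zero_excess sumrB sumr_const cardT -cardE -mulr_sumr (bigD1 0) //=.
by rewrite eqxx big1 ?addr0 ?mulr1 ?natz ?subrr // => t /negPf->.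
Qed.

Lemma sum_zero_excess_affine (F : finFieldType) (a c : F) : a != 0 ->
  \sum_t zero_excess (c + a * t) = 0.
Proof.
move=> a_neq0; rewrite -[RHS](sum_zero_excess F) [RHS](reindex (fun t => c + a
  * t)) //.
exists (fun t => a^-1 * (t - c)) => t _ /=.
  by rewrite addrAC subrr add0r mulKf.
by rewrite mulVKf // addrC subrK.
Qed.

(** * Zeros of diagonal quadratic forms *)

Definition binary_excess (F : finFieldType) (a b c : F) : int :=
  \sum_x \sum_y zero_excess (c + a * x ^+ 2 + b * y ^+ 2).

Lemma binary_excess_sqr (F : finFieldType) (a b c t : F) : t != 0 ->
  binary_excess a (b * t ^+ 2) c = binary_excess a b c.
Proof.
move=> t_neq0; apply: eq_bigr => x _.
rewrite [RHS](reindex (fun y => t * y)) /=; last first.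
  by exists (fun y => t^-1 * y) => y _; rewrite ?mulKf ?mulVKf.
by apply: eq_bigr => y _; congr zero_excess; ring.
Qed.

(* Substituting u = a x - s y, where s^2 = - a b, makes the argument affine   *)
(* in y for each u <> 0, so that only u = 0 contributes.                      *)
Lemma binary_excess_split (F : finFieldType) (a b c : F) :
  odd #|F| -> a != 0 -> b != 0 -> quadratic_char (- (a * b)) = 1 ->
  binary_excess a b c = #|F|%:Z * zero_excess c.
Proof.
move=> oddF a_neq0 b_neq0 /quadratic_char1P[s s_neq0 def_s].
rewrite /binary_excess exchange_big /=.
have -> : \sum_y \sum_x zero_excess (c + a * x ^+ 2 + b * y ^+ 2) =
  \sum_y \sum_u zero_excess (a * c + u ^+ 2 + 2 * s * u * y).
  apply: eq_bigr => y _.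
  rewrite [RHS](reindex (fun x => a * x - s * y)) /=; last first.
    exists (fun u => a^-1 * (u + s * y)) => x _; first by rewrite subrK mulKf.
    by rewrite mulVKf // addrK.
  (* After multiplication by [a], the form is (a x)^2 - (s y)^2, the product of u and u + 2 s y. *)
  apply: eq_bigr => x _; rewrite -(zero_excessM _ a_neq0); congr zero_excess.
  by rewrite !mulrDr [a * (b * _)]mulrA -[a * b]opprK def_s; ring.
rewrite exchange_big (bigD1 0) //= [X in _ + X]big1 ?addr0 => [|u u_neq0].
  under eq_bigr do rewrite expr0n addr0 mulr0 mul0r addr0.
  by rewrite sumr_const zero_excessM // cardT -cardE -mulr_natl natz.
by rewrite sum_zero_excess_affine // !mulf_neq0 ?odd_card_natr2_neq0.
Qed.

(** The sum over all b, 0 included, equals its term at b = 0: for y <> 0 the argument is affine in b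
    and gives 0, and for y = 0 it does not depend on b. *)
Lemma sum_binary_excess (F : finFieldType) (a c : F) :
  \sum_(b | b != 0) binary_excess a b c = 0.
Proof.
suff : \sum_b binary_excess a b c = binary_excess a 0 c.
  by rewrite (bigD1 0) //= => /(canRL (addKr _)) ->; rewrite addNr.
rewrite /binary_excess exchange_big; apply: eq_bigr => x _.
rewrite exchange_big (bigD1 0) //= [X in _ + X]big1 ?addr0 => [|y y_neq0].
  apply: esym; rewrite (eq_bigr (fun=> zero_excess (c + a * x ^+ 2))).
    by apply: eq_bigr => b _; rewrite expr0n mulr0 addr0.
  by move=> y _; rewrite mul0r addr0.
under eq_bigr do rewrite [_ * y ^+ 2]mulrC.
by rewrite sum_zero_excess_affine // expf_neq0.
Qed.

(* One of b and v b is a square and the other is not, so the left-hand side   *)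
(* does not depend on b; by sum_binary_excess its average over b is 0.        *)
Lemma binary_excess_nonsquare (F : finFieldType) (a b c v : F) :
  odd #|F| -> b != 0 -> quadratic_char v = -1 ->
  binary_excess a b c + binary_excess a (v * b) c = 0.
Proof.
move=> oddF b_neq0 nsq_v.
have v_neq0 : v != 0 by apply: contra_eq_neq nsq_v => ->;
  rewrite quadratic_char0.
pose S b := binary_excess a b c; rewrite -!/(S _).
have constS d : d != 0 -> S d + S (v * d) = S 1 + S v.
  move=> d_neq0; have [/quadratic_char1P[t t_neq0 ->] | nsq_d] :=
    quadratic_char_sign d_neq0.
    by rewrite -[X in S X + _]mul1r /S !binary_excess_sqr.
  have [|t t_neq0 def_t] := @quadratic_char1P F (v * d).
    by rewrite quadratic_charM // nsq_v nsq_d.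
  (* For d a nonsquare, v d = t^2 is a square and d is v times a square, so the two terms trade
     places. *)
  have -> : d = v * (t / v) ^+ 2 by rewrite expr_div_n -def_t; field.
  rewrite addrC /S !binary_excess_sqr ?mulf_neq0 ?invr_eq0 //; congr (_ + _).
  have -> : v * (v * (t / v) ^+ 2) = 1 * t ^+ 2 by field.
  by rewrite binary_excess_sqr.
have sumS : \sum_(d | d != 0) S d = 0 by apply: sum_binary_excess.
have sumvS : \sum_(d | d != 0) S (v * d) = 0.
  rewrite -[RHS]sumS [RHS](reindex (fun d => v * d)) /=.
    by apply: eq_bigl => d; rewrite mulf_eq0 (negPf v_neq0).
  by exists (fun y => v^-1 * y) => y _; rewrite ?mulKf ?mulVKf.
have /eqP : \sum_(d : F | d != 0) (S d + S (v * d)) = 0.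
  by rewrite big_split /= sumS sumvS addr0.
rewrite (eq_bigr (fun=> S 1 + S v) constS) sumr_const mulrn_eq0 (cardC1 (0 :
  F)).
have := finNzRing_gt1 F; case: #|F| => [|[|n]] // _ /= /eqP S1v.
by rewrite constS.
Qed.

(** If - (a b) is not a square, multiplying b by a nonsquare v leads to the split case, and
    [binary_excess_nonsquare] returns to b with a change of sign. *)
Lemma binary_excessE (F : finFieldType) (a b c : F) :
  odd #|F| -> a != 0 -> b != 0 ->
  binary_excess a b c =
    #|F|%:Z * quadratic_char (- (a * b)) * zero_excess c.
Proof.
move=> oddF a_neq0 b_neq0.
have ab_neq0 : - (a * b) != 0 by rewrite oppr_eq0 mulf_neq0.
have [sq_ab | nsq_ab] := quadratic_char_sign ab_neq0.
  by rewrite sq_ab mulr1 binary_excess_split.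
have [v nsq_v] := nonsquare_exists oddF.
have v_neq0 : v != 0 by apply: contra_eq_neq nsq_v => ->;
  rewrite quadratic_char0.
have /eqP := binary_excess_nonsquare a c oddF b_neq0 nsq_v.
rewrite addr_eq0 nsq_ab => /eqP ->; rewrite binary_excess_split ?mulf_neq0 //.
  by rewrite mulrN1 mulNr.
by rewrite mulrCA -mulrN quadratic_charM // nsq_v nsq_ab.
Qed.

(** The accumulator [c] holds the contribution of the coordinates already fixed, so that
    coefficients can be peeled off one at a time. *)
Fixpoint diag_sum (F : finFieldType) (h : F -> int) (ds : seq F) (c : F) : int
  :=
  if ds is a :: ds' then \sum_x diag_sum h ds' (c + a * x ^+ 2) else h c.

Lemma diag_sum_shift (F : finFieldType) (h : F -> int) ds a c :
  diag_sum (fun t => h (a + t)) ds c = diag_sum h ds (a + c).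
Proof.
elim: ds c => //= b ds IHds c.
by apply: eq_bigr => x _; rewrite IHds addrA.
Qed.

(** Each pair a, b of coefficients contributes the factor q eta(- a b) and leaves [zero_excess c]
    behind, which keeps the induction going. *)
Lemma diag_sum_even (F : finFieldType) m (ds : seq F) c :
  odd #|F| -> size ds = m.*2 -> all (fun d => d != 0) ds ->
  diag_sum (@zero_excess F) ds c =
    #|F|%:Z ^+ m * quadratic_char ((-1) ^+ m * \prod_(d <- ds) d)
      * zero_excess c.
Proof.
move=> oddF; elim: m ds c => [|m IHm] [|a [|b ds]] //= c.
  move=> _ _; rewrite big_nil mulr1 expr0 mul1r.
  by have := quadratic_charX (0 : F) 0 oddF; rewrite !expr0 => ->;
    rewrite mul1r.
move=> [sz_ds] /and3P[a_neq0 b_neq0 ds_neq0].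
under eq_bigr do under eq_bigr do rewrite IHm //.
under eq_bigr do rewrite -mulr_sumr.
rewrite -mulr_sumr -/(binary_excess a b c) binary_excessE // !big_cons.
have -> : (-1) ^+ m.+1 * (a * (b * \prod_(d <- ds) d)) =
    - (a * b) * ((-1) ^+ m * \prod_(d <- ds) d) by rewrite exprS; ring.
by rewrite [in RHS]quadratic_charM // exprS; ring.
Qed.

(** All coefficients but one go in pairs; the remaining variable gives q - 1 at 0 and -1 at each of
    the q - 1 other points. *)
Lemma diag_sum_odd (F : finFieldType) (ds : seq F) :
  odd #|F| -> odd (size ds) -> all (fun d => d != 0) ds ->
  diag_sum (@zero_excess F) ds 0 = 0.
Proof.
case: ds => //= a ds oddF even_ds /andP[a_neq0 ds_neq0].
have /esym sz_ds := odd_double_half (size ds); rewrite (negPf even_ds) in sz_ds.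
under eq_bigr do rewrite (diag_sum_even _ oddF sz_ds) // add0r zero_excessM //.
rewrite -mulr_sumr; apply/eqP; rewrite mulf_eq0; apply/orP; right.
rewrite (bigD1 0) //= expr0n zero_excess0 (eq_bigr (fun=> -1)) => [|x x_neq0].
  rewrite sumr_const (cardC1 (0 : F)).
  by have := finNzRing_gt1 F; case: #|F| => // n _ /=; rewrite mulNrn natz; lia.
by rewrite /zero_excess expf_eq0 (negPf x_neq0) mulr0 sub0r.
Qed.

(** * Symmetric matrices and principal minors *)

Definition qform (R : comNzRingType) n (A : 'M[R]_n) (x : 'rV[R]_n) : R :=
  (x *m A *m x^T) 0 0.

Lemma sum_qform_congr (F : finFieldType) (h : F -> int) n (A T : 'M[F]_n) :
  T \in unitmx ->
  \sum_x h (qform (T *m A *m T^T) x) = \sum_x h (qform A x).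
Proof.
move=> T_unit; rewrite [RHS](reindex (fun x => x *m T)) /=; last first.
  by exists (fun x => x *m invmx T) => x _; rewrite ?mulmxK ?mulmxKV.
by apply: eq_bigr => x _; rewrite /qform trmx_mul !mulmxA.
Qed.

Lemma sum_row_mx (F : finFieldType) n (h : 'rV[F]_(1 + n) -> int) :
  \sum_x h x = \sum_(t : F) \sum_(y : 'rV_n) h (row_mx t%:M y).
Proof.
rewrite pair_bigA (reindex (fun p : F * 'rV_n => row_mx p.1%:M p.2)) //=.
exists (fun x => (lsubmx x 0 0, rsubmx x)) => [[t y] _ | x _] /=.
  by rewrite row_mxKl row_mxKr mxE eqxx.
by rewrite -mx11_scalar hsubmxK.
Qed.

(** Polarization: if the form vanished on all basis vectors and their sums, then 2 P_ij = 0 for all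
    i, j, and 2 is invertible. *)
Lemma qform_neq0_exists (F : finFieldType) n (P : 'M[F]_n) :
  odd #|F| -> P^T = P -> P != 0 -> exists v, qform P v != 0.
Proof.
move=> oddF symP P_neq0; apply/existsP; apply: contra_neqT P_neq0.
rewrite negb_exists => /forallP P0.
have qP0 v : qform P v = 0 by apply/eqP; rewrite -[_ == _]negbK.
have eqf i j : ((delta_mx 0 i : 'rV_n) *m P *m (delta_mx 0 j : 'rV_n)^T) 0 0 =
  P i j.
  by rewrite -rowE trmx_delta -colE !mxE.
apply/matrixP => i j; rewrite mxE.
have := qP0 (delta_mx 0 i + delta_mx 0 j).
rewrite /qform raddfD /= mulmxDl !mulmxDr !mulmxDl.
move: (qP0 (delta_mx 0 i)) (qP0 (delta_mx 0 j)); rewrite /qform !eqf.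
rewrite ![((_ + _) : 'M__) 0 0]mxE !eqf => -> ->; rewrite add0r addr0.
have -> : P j i = P i j by rewrite -[in LHS]symP mxE.
rewrite -mulr2n -mulr_natl => /eqP.
by rewrite mulf_eq0 (negPf (odd_card_natr2_neq0 oddF)) => /eqP.
Qed.

(** Completes v, up to a scalar, to a basis: v has rank 1, so the first row of [row_ebase v] spans
    it. *)
Lemma unitmx_row0 (F : fieldType) n (v : 'rV[F]_n.+1) :
  v != 0 -> exists2 T : 'M_n.+1, T \in unitmx & exists c, v = c *: row 0 T.
Proof.
move=> v_neq0; exists (row_ebase v); first exact: row_ebase_unit.
exists (col_ebase v 0 0); rewrite -[LHS](mulmx_ebase v) rowE.
have -> : \rank v = 1%N by rewrite rank_rV v_neq0.
rewrite {1}[col_ebase v]mx11_scalar mul_scalar_mx -scalemxAl; congr (_ *: _).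
congr (_ *m _).
by apply/rowP => j; rewrite !mxE -val_eqE /= andbT eq_sym.
Qed.

(** One step of symmetric Gaussian elimination; the lower right block is the Schur complement of
    [a]. *)
Lemma complete_square (F : fieldType) n (a : F) (b : 'rV_n) (C : 'M[F]_n) :
  a != 0 ->
  let E : 'M_(1 + n) := block_mx 1%:M 0 (- (a^-1 *: b^T)) 1%:M in
  E *m block_mx a%:M b b^T C *m E^T =
    block_mx a%:M 0 0 (C - a^-1 *: (b^T *m b)).
Proof.
move=> a_neq0 E; rewrite /E tr_block_mx !mulmx_block !trmx1 trmx0.
rewrite !(mul1mx, mulmx1, mul0mx, mulmx0, addr0, add0r) linearN /=.
rewrite [(a^-1 *: _)^T]linearZ /= trmxK; congr block_mx.
- by rewrite mulmxN mul_scalar_mx scalerA divff // scale1r addrC subrr.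
- by rewrite mulNmx -scalemxAl mul_mx_scalar scalerA mulVf // scale1r addrC
  subrr.
rewrite mulNmx -scalemxAl mul_mx_scalar scalerA mulVf // scale1r.
by rewrite [- _ + b^T]addrC subrr mul0mx add0r mulNmx -scalemxAl addrC.
Qed.

(** A vector with nonzero value is made the first basis vector, the square is completed, and the
    Schur complement is treated by induction. The determinant is controlled up to a nonzero square,
    which is all that the quadratic character sees. *)
Lemma diagonalize (F : finFieldType) n (P : 'M[F]_n) :
  odd #|F| -> P^T = P -> P \in unitmx ->
  exists ds : seq F,
    [/\ size ds = n,
        exists2 u, u != 0 & \prod_(d <- ds) d = u ^+ 2 * \det P
      & forall h : F -> int, \sum_x h (qform P x) = diag_sum h ds 0].
Proof.
move=> oddF; elim: n P => [|n IHn] P symP P_unit.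
  exists [::]; split=> // [|h].
    by exists 1; rewrite ?oner_neq0 // big_nil det_mx00 expr1n mulr1.
  rewrite (big_pred1 0) => [|x]; first by rewrite /qform !mul0mx mxE.
  exact/esym/eqP/thinmx0.
have P_neq0 : P != 0.
  apply: contraTneq P_unit => ->.
  by rewrite unitmxE det0 unitr0.
have [v v_neq0] := qform_neq0_exists oddF symP P_neq0.
have [|T T_unit [c def_v]] := @unitmx_row0 F n v.
  by apply: contraNneq v_neq0 => ->; rewrite /qform !mul0mx mxE.
pose Q : 'M_(1 + n) := T *m P *m T^T.
have symQ : Q^T = Q by rewrite /Q !trmx_mul trmxK symP mulmxA.
pose a := Q 0 0.
have a_neq0 : a != 0.
  apply: contraNneq v_neq0 => a0.
  have: qform P (row 0 T) = 0.
    by rewrite -a0 /a /Q /qform tr_row -row_mul -mulmxA -!row_mul mulmxA !mxE;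
       apply: eq_bigr => k _; rewrite !mxE.
  by rewrite def_v /qform linearZ /= -!scalemxAl -scalemxAr !mxE => ->;
    rewrite !mulr0.
pose b : 'rV_n := ursubmx Q; pose C := drsubmx Q.
have def_Q : Q = block_mx a%:M b b^T C.
  rewrite -[LHS](submxK Q); congr block_mx.
    rewrite [LHS]mx11_scalar; congr (_%:M).
    have lshift00 : lshift n (0 : 'I_1) = 0 by exact: val_inj.
    by rewrite /a -lshift00 -[in RHS](submxK Q) block_mxEul.
  by rewrite trmx_ursub symQ.
pose E : 'M_(1 + n) := block_mx 1%:M 0 (- (a^-1 *: b^T)) 1%:M.
pose P' := C - a^-1 *: (b^T *m b).
have detE : \det E = 1 by rewrite /E det_lblock !det1 mulr1.
have def_R : E *m Q *m E^T = block_mx a%:M 0 0 P'.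
  by rewrite def_Q complete_square.
have detT : \det T != 0 by rewrite -unitfE -unitmxE.
have detP' : a * \det P' = \det T ^+ 2 * \det P.
  have := congr1 determinant def_R; rewrite det_ublock det_scalar1 => <-.
  by rewrite !det_mulmx !det_tr detE; ring.
have [||ds [sz_ds [u u_neq0 prod_ds] sum_ds]] := IHn P'.
- by rewrite /P' linearB linearZ /= trmx_mul trmxK; congr (_ - _);
  rewrite /C trmx_drsub symQ.
- rewrite unitmxE unitfE; apply: contraTneq P_unit => detP'0.
  by rewrite unitmxE unitfE; move/esym/eqP: detP';
    rewrite detP'0 mulr0 mulf_eq0 expf_eq0 (negPf detT) /= negbK.
exists (a :: ds); split=> [|| h]; first by rewrite /= sz_ds.
  exists (u * \det T); first exact: mulf_neq0.
  by rewrite big_cons prod_ds mulrCA detP'; ring.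
have -> : \sum_x h (qform P x) =
    \sum_x h (qform (block_mx a%:M 0 0 P' : 'M_(1 + n)) x).
  rewrite -def_R sum_qform_congr; last by rewrite unitmxE detE unitr1.
  by rewrite sum_qform_congr.
rewrite sum_row_mx /=; apply: eq_bigr => t _.
(* The square just split off is absorbed into [h], so that the induction hypothesis applies with
   accumulator 0. *)
rewrite [0 + _ in RHS]addrC -diag_sum_shift -sum_ds; apply: eq_bigr => y _.
congr h; rewrite /qform mul_row_block !mulmx0 addr0 add0r tr_row_mx mul_row_col.
rewrite -scalar_mxM mxE tr_scalar_mx -scalar_mxM mxE eqxx; congr (_ + _).
by rewrite mulr1n; ring.
Qed.

(** By [J] the map x |-> x X is onto, so its fibres are translates of its kernel, of size K with K
    q^r = q^n. The powers on both sides avoid a division in [int]. *)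
Lemma sum_qform_surj (F : finFieldType) n r (X : 'M[F]_(n, r)) (J : 'M_(r, n))
    (P : 'M_r) (h : F -> int) : J *m X = 1%:M ->
  #|F|%:Z ^+ r * \sum_x h (qform (X *m P *m X^T) x) =
    #|F|%:Z ^+ n * \sum_y h (qform P y).
Proof.
move=> JX1; pose K := #|[set x : 'rV_n | x *m X == 0]|.
have fiber (f : 'rV_r -> int) : \sum_x f (x *m X) = K%:Z * \sum_y f y.
  rewrite (partition_big (fun x => x *m X) predT) //= mulr_sumr.
  apply: eq_bigr => y _; rewrite (eq_bigr (fun=> f y)) => [|x /eqP-> //].
  rewrite sumr_const -mulr_natl natz; congr (_ %:Z * _).
  rewrite /K -[RHS](card_imset _ (addIr (y *m J))).
  apply: eq_card => x; apply/idP/imsetP => [xXy | [z]].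
    have xX : x *m X = y by apply/eqP.
    exists (x - y *m J); last by rewrite subrK.
    by rewrite inE mulmxBl -mulmxA JX1 mulmx1 xX subrr.
  by rewrite inE => /eqP zX ->; apply/eqP; rewrite mulmxDl -mulmxA JX1 mulmx1
    zX add0r.
have cardK : #|F|%:Z ^+ n = K%:Z * #|F|%:Z ^+ r.
  have := fiber (fun=> 1); rewrite !sumr_const !cardT -!cardE !card_mx !mul1n.
  by rewrite !natrX !natz.
rewrite cardK mulrAC mulrC -fiber; congr (_ * _); apply: eq_bigr => x _.
by rewrite /qform trmx_mul !mulmxA.
Qed.

(** With J selecting rows that form a basis of the row space, A = X J A. Transposing gives A = A J^T
    X^T, whence P = J A J^T, a principal block, invertible because its rank is at least that of
    A. *)
Lemma sym_rank_factor (F : fieldType) n (A : 'M[F]_n) : A^T = A ->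
  exists f : 'I_(\rank A) -> 'I_n, exists X : 'M_(n, \rank A),
  exists P : 'M_(\rank A),
    [/\ injective f, rowsub f 1%:M *m X = 1%:M, A = X *m P *m X^T,
        P^T = P & P \in unitmx].
Proof.
move=> symA; pose f := maxrankfun A; pose J : 'M_(_, n) := rowsub f (1%:M :
  'M[F]_n).
have JA : J *m A = rowsub f A by rewrite /J -rowsubE.
have [X def_A] : exists X, A = X *m rowsub f A.
  by apply/submxP; rewrite (eq_maxrowsub A).
have JX1 : J *m X = 1%:M.
  by apply: (row_free_inj (maxrowsub_free A)); rewrite /= mul1mx -mulmxA -def_A.
pose P := J *m A *m J^T.
have symP : P^T = P by rewrite /P !trmx_mul trmxK symA mulmxA.
have def_P : A = X *m P *m X^T.
  have : (X *m (J *m A))^T = A^T by rewrite JA -def_A.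
  by rewrite !trmx_mul symA -mulmxA => AJX; rewrite /P -!mulmxA AJX JA.
exists f, X, P; split=> //; first exact: maxrankfun_inj.
rewrite -row_free_unit -row_leq_rank; have := mxrankM_maxl (X *m P) X^T.
by rewrite -def_P => /leq_trans; apply; apply: mxrankM_maxr.
Qed.

(* The principal submatrix of A indexed by I, kept square by an identity      *)
(* block on the complement of I.                                              *)
Definition principal_mx (R : nzRingType) n (A : 'M[R]_n) (I : {set 'I_n}) :
  'M[R]_n :=
  \matrix_(i, j) if (i \in I) && (j \in I) then A i j else (i == j)%:R.

(** Sylvester's identity: L M and M L are block triangular, and their equal determinants are the two
    sides. *)
Lemma det_1_add_mulmx (R : comNzRingType) m n (U : 'M[R]_(m, n)) (V : 'M_(n,
  m)) :
  \det (1%:M + U *m V) = \det (1%:M + V *m U).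
Proof.
pose L : 'M_(m + n) := block_mx 1%:M U 0 1%:M.
pose M : 'M_(m + n) := block_mx 1%:M (- U) V 1%:M.
have detL : \det L = 1 by rewrite det_ublock !det1 mulr1.
have : \det (L *m M) = \det (M *m L) by rewrite !det_mulmx mulrC.
rewrite !mulmx_block !(mul1mx, mulmx1, mul0mx, mulmx0, addr0, add0r).
rewrite addNr subrr !det_lblock !det1 mulr1 mul1r => ->.
by rewrite addrC.
Qed.

(** The padded matrix is 1 + J^T (J A J^T - 1) J, and J J^T = 1, so Sylvester's identity leaves the
    small determinant. *)
Lemma det_principal_mx (R : comNzRingType) n k (A : 'M[R]_n) (f : 'I_k -> 'I_n)
  :
  injective f -> let J := rowsub f 1%:M in
  \det (principal_mx A (f @: setT)) = \det (J *m A *m J^T).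
Proof.
move=> f_inj J.
have JE a i : J a i = (f a == i)%:R by rewrite !mxE.
have JJ1 : J *m J^T = 1%:M.
  apply/matrixP => a b; rewrite !mxE (bigD1 (f a)) //= !mxE eqxx mul1r big1 =>
    [|i ne_i].
    by rewrite addr0 (inj_eq f_inj) eq_sym.
  by rewrite !mxE eq_sym (negPf ne_i) mul0r.
have JAJE (B : 'M_n) a b : (J *m B *m J^T) a b = B (f a) (f b).
  rewrite mxE (bigD1 (f b)) //= big1 => [|i ne_i].
    rewrite !mxE eqxx mulr1 addr0 (bigD1 (f a)) //= big1 => [|i ne_i].
      by rewrite JE eqxx mul1r addr0.
    by rewrite JE eq_sym (negPf ne_i) mul0r.
  by rewrite [J^T _ _]mxE JE eq_sym (negPf ne_i) mulr0.
have -> : principal_mx A (f @: setT) = 1%:M + J^T *m ((J *m A *m J^T - 1%:M) *m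
  J).
  apply/matrixP => i j; rewrite !mxE.
  case: ifP => [/andP[/imsetP[a _ ->] /imsetP[b _ ->]] | notI].
    rewrite (bigD1 a) //= big1 ?addr0 => [|c ne_c]; last first.
      by rewrite [J^T _ _]mxE JE (inj_eq f_inj) (negPf ne_c) mul0r.
    rewrite [J^T _ _]mxE JE eqxx mul1r mxE (bigD1 b) //= big1 ?addr0 => [|c
      ne_c]; last first.
      by rewrite JE (inj_eq f_inj) (negPf ne_c) mulr0.
    rewrite JE eqxx mulr1 mxE JAJE !mxE (inj_eq f_inj).
    by rewrite addrC subrK.
  rewrite big1 ?addr0 // => a _; rewrite [J^T _ _]mxE JE.
  case: (eqVneq (f a) i) => [fa | _]; last by rewrite mul0r.
  rewrite mul1r mxE big1 // => b _; rewrite JE.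
  case: (eqVneq (f b) j) => [fb | _]; last by rewrite mulr0.
  by rewrite -fa -fb !imset_f ?inE in notI.
rewrite det_1_add_mulmx -mulmxA JJ1 mulmx1; congr (\det _).
by rewrite addrC subrK.
Qed.

Lemma principal_mx_enum (R : comNzRingType) n (A : 'M[R]_n) (I : {set 'I_n}) :
  let J := rowsub (fun a : 'I_#|I| => enum_val a) 1%:M in
  \det (principal_mx A I) = \det (J *m A *m J^T).
Proof.
rewrite /= -det_principal_mx; last exact: enum_val_inj.
congr (\det (principal_mx _ _)); apply/setP => i;
  apply/idP/imsetP => [Ii | [a _ ->]].
  by exists (enum_rank_in Ii i); rewrite ?inE // enum_rankK_in.
exact: enum_valP.
Qed.

Lemma leq_principal_rank (F : fieldType) n (A : 'M[F]_n) (I : {set 'I_n}) :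
  \det (principal_mx A I) != 0 -> (#|I| <= \rank A)%N.
Proof.
rewrite principal_mx_enum -unitfE -unitmxE => /mxrank_unit {1}<-.
exact: leq_trans (mxrankM_maxl _ _) (mxrankM_maxr _ _).
Qed.

Lemma principal_rank_exists (F : fieldType) n (A : 'M[F]_n) : A^T = A ->
  exists2 I : {set 'I_n}, #|I| = \rank A & \det (principal_mx A I) != 0.
Proof.
case/sym_rank_factor=> f [X [P [f_inj JX1 def_A _ P_unit]]].
exists (f @: setT); first by rewrite card_imset // cardsT card_ord.
rewrite det_principal_mx // [in X in \det (_ *m X *m _)]def_A.
rewrite !mulmxA JX1 mul1mx -mulmxA -trmx_mul JX1 trmx1 mulmx1.
by rewrite -unitfE -unitmxE.
Qed.

(** Here [J *m X] is square, so all principal minors of order r agree with det P up to squares. *)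
Lemma det_max_principal (F : fieldType) n r k (A : 'M[F]_n) (X : 'M_(n, r))
    (P : 'M_r) (J : 'M_(k, n)) : k = r -> A = X *m P *m X^T ->
  exists c, \det (J *m A *m J^T) = c ^+ 2 * \det P.
Proof.
move=> eq_kr; subst k => ->; exists (\det (J *m X)).
rewrite !mulmxA -mulmxA -trmx_mul 2!det_mulmx det_tr; ring.
Qed.

Lemma max_principal_char (F : finFieldType) n (A : 'M[F]_n) (I I' : {set 'I_n})
  :
  odd #|F| -> A^T = A -> #|I| = \rank A -> #|I'| = \rank A ->
  \det (principal_mx A I) != 0 -> \det (principal_mx A I') != 0 ->
  quadratic_char (\det (principal_mx A I)) =
    quadratic_char (\det (principal_mx A I')).
Proof.
move=> oddF /sym_rank_factor[f [X [P [_ _ def_A _ _]]]] rI rI'.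
rewrite !principal_mx_enum.
have [c ->] := det_max_principal (rowsub (fun a : 'I_#|I| => enum_val a) 1%:M)
  rI def_A.
have [c' ->] := det_max_principal (rowsub (fun a : 'I_#|I'| => enum_val a)
  1%:M) rI' def_A.
have sqr_neq0 (a : F) : a ^+ 2 * \det P != 0 -> a != 0.
  by apply: contraNneq => ->; rewrite expr0n mul0r.
move=> /sqr_neq0 c_neq0 /sqr_neq0 c'_neq0.
by rewrite !(quadratic_charM _ (\det P)) // !quadratic_char_sqr.
Qed.

Lemma sum_zero_excess_qform_even (F : finFieldType) n m (A : 'M[F]_n) (I : {set
  'I_n}) :
  odd #|F| -> A^T = A -> #|I| = \rank A -> \det (principal_mx A I) != 0 ->
  \rank A = m.*2 ->
  #|F|%:Z ^+ m * \sum_x zero_excess (qform A x) =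
    #|F|%:Z ^+ n * (#|F|%:Z - 1) *
      quadratic_char ((-1) ^+ m * \det (principal_mx A I)).
Proof.
move=> oddF /sym_rank_factor[f [X [P [_ JX1 def_A symP P_unit]]]] rI.
rewrite principal_mx_enum.
have [c ->] := det_max_principal (rowsub (fun a : 'I_#|I| => enum_val a) 1%:M)
  rI def_A.
rewrite mulf_eq0 negb_or expf_eq0 /= => /andP[c_neq0 detP] rA.
have [ds [sz_ds [u u_neq0 prod_ds] sum_ds]] := diagonalize oddF symP P_unit.
have ds_neq0 : all (fun d => d != 0) ds.
  have: \prod_(d <- ds) d != 0 by rewrite prod_ds mulf_neq0 ?expf_neq0.
  by rewrite prodf_seq_neq0.
have q_neq0 : #|F|%:Z ^+ m != 0.
  by rewrite expf_neq0 //; have := finNzRing_gt1 F; case: #|F|.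
(* A second factor q^m brings the power to q^(\rank A), as [sum_qform_surj] requires. *)
apply: (mulfI q_neq0); rewrite mulrA -exprD addnn -rA.
have := sum_qform_surj P (@zero_excess F) JX1; rewrite -def_A => ->.
rewrite sum_ds (@diag_sum_even _ m) // -?rA // zero_excess0 prod_ds.
rewrite [(-1) ^+ m * (u ^+ 2 * _)]mulrCA [(-1) ^+ m * (c ^+ 2 * _)]mulrCA.
rewrite [in LHS]quadratic_charM // [in RHS]quadratic_charM //.
by rewrite !quadratic_char_sqr // !mul1r; ring.
Qed.

Lemma sum_zero_excess_qform_odd (F : finFieldType) n (A : 'M[F]_n) :
  odd #|F| -> A^T = A -> odd (\rank A) -> \sum_x zero_excess (qform A x) = 0.
Proof.
move=> oddF /sym_rank_factor[f [X [P [_ JX1 def_A symP P_unit]]]] rA.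
have [ds [sz_ds [u u_neq0 prod_ds] sum_ds]] := diagonalize oddF symP P_unit.
have ds_neq0 : all (fun d => d != 0) ds.
  have: \prod_(d <- ds) d != 0.
    by rewrite prod_ds mulf_neq0 ?expf_neq0 // -unitfE -unitmxE.
  by rewrite prodf_seq_neq0.
have := sum_qform_surj P (@zero_excess F) JX1; rewrite -def_A sum_ds.
rewrite diag_sum_odd ?sz_ds // mulr0 => /eqP; rewrite mulf_eq0 expf_eq0.
by have := finNzRing_gt1 F; case: #|F| => // q _; rewrite andbF => /eqP.
Qed.

(** * Spanning trees and identification of vertices *)

(* Adjacency in G once the vertices of W are identified.                      *)
Definition adjacent_mod (G : multigraph) (W : {set vertex G}) (T : {set edge
  G}) :
    rel (vertex G) :=
  fun u v => (u \in W) && (v \in W) || adjacent T u v.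

(** Connectedness in G/W stated inside G, so that W can grow in an induction without changing the
    types of vertices and edges. *)
Definition connected_mod (G : multigraph) (W : {set vertex G}) (T : {set edge
  G}) : bool :=
  [forall u, forall v, connect (adjacent_mod W T) u v].

Lemma joins_sym (G : multigraph) (e : edge G) : symmetric (joins e).
Proof. by move=> u v; rewrite /joins orbC. Qed.

Lemma joins_src_tgt (G : multigraph) (e : edge G) : joins e (src e) (tgt e).
Proof. by rewrite /joins !eqxx. Qed.

Lemma joinsP (G : multigraph) (e : edge G) u v x y : joins e u v -> joins e x y
  ->
  (x = u /\ y = v) \/ (x = v /\ y = u).
Proof.
rewrite /joins => /orP[] /andP[/eqP<- /eqP<-] /orP[] /andP[/eqP<- /eqP<-];
  tauto.
Qed.

Lemma adjacent_sym (G : multigraph) (T : {set edge G}) : symmetric (adjacent T).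
Proof. by move=> u v; apply: eq_existsb => e; rewrite joins_sym. Qed.

Lemma connect_adjacent_sym (G : multigraph) (T : {set edge G}) :
  connect_sym (adjacent T).
Proof. exact/sym_connect_sym/adjacent_sym. Qed.

Lemma adjacent_mod_sym (G : multigraph) (W : {set vertex G}) (T : {set edge G})
  :
  symmetric (adjacent_mod W T).
Proof. by move=> u v; rewrite /adjacent_mod andbC adjacent_sym. Qed.

Lemma connect_mod_sym (G : multigraph) (W : {set vertex G}) (T : {set edge G}) :
  connect_sym (adjacent_mod W T).
Proof. exact/sym_connect_sym/adjacent_mod_sym. Qed.

Lemma adjacent_edge (G : multigraph) (T : {set edge G}) e u v :
  e \in T -> joins e u v -> adjacent T u v.
Proof. by move=> Te e_uv; apply/existsP; exists e; rewrite Te. Qed.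

Lemma connected_modP (G : multigraph) (W : {set vertex G}) (T : {set edge G}) :
  reflect (forall u v, connect (adjacent_mod W T) u v) (connected_mod W T).
Proof.
apply: (iffP forallP) => [cT u v | cT u]; first by have /forallP := cT u.
exact/forallP/cT.
Qed.

Lemma eq_connected_mod (G : multigraph) (W W' : {set vertex G}) (T T' : {set
  edge G}) :
  connect (adjacent_mod W T) =2 connect (adjacent_mod W' T') ->
  connected_mod W T = connected_mod W' T'.
Proof. by move=> eqc; apply: eq_forallb => u; apply: eq_forallb => v. Qed.

(** Contraction of e: absorbing v into the class of W does the work of the edge e. *)
Lemma connected_mod_edge (G : multigraph) (W : {set vertex G}) (T : {set edge
  G}) e w v :
  w \in W -> e \in T -> joins e w v ->
  connected_mod W T = connected_mod (v |: W) (T :\ e).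
Proof.
move=> Ww Te e_wv; apply: eq_connected_mod => x y; apply/idP/idP.
  apply: connect_sub => a b /orP[/andP[Wa Wb] | /existsP[f /andP[Tf f_ab]]].
    by apply: connect1; rewrite /adjacent_mod !inE Wa Wb !orbT.
  have [def_f | ne_f] := eqVneq f e.
    rewrite def_f in f_ab; apply: connect1; rewrite /adjacent_mod !inE.
    by have [] := joinsP e_wv f_ab => -[-> ->]; rewrite eqxx Ww !orbT.
  apply: connect1; apply/orP; right.
  by apply: (adjacent_edge _ f_ab); rewrite !inE ne_f.
apply: connect_sub => a b /orP[|/existsP[f /andP[Tf f_ab]]]; last first.
  apply: connect1; apply/orP; right; apply: (adjacent_edge _ f_ab).
  by move: Tf; rewrite !inE => /andP[].
have to_w u : u \in v |: W -> connect (adjacent_mod W T) w u.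
  rewrite !inE => /orP[/eqP-> | Wu]; apply: connect1; apply/orP.
    by right; apply: adjacent_edge e_wv.
  by left; rewrite Ww.
by case/andP=> /to_w wa /to_w wb; apply: connect_trans wb;
  rewrite connect_mod_sym.
Qed.

Lemma connected_mod_crossing (G : multigraph) (W : {set vertex G}) (T : {set
  edge G}) :
  W != set0 -> W != setT -> connected_mod W T ->
  exists e w v, [/\ e \in T, w \in W, v \notin W & joins e w v].
Proof.
case/set0Pn=> w0 Ww0 neT /connected_modP cT.
have [v0 Wv0] : exists v0, v0 \notin W.
  by apply/existsP; apply: contraNT neT => /existsPn allW; apply/eqP/setP => v;
     rewrite inE; apply/negPn/allW.
have [/existsP[e /existsP[w /existsP[v /and4P[]]]] | noX] :=
    boolP [exists e, exists w, exists v, [&& e \in T, w \in W, v \notin W &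
      joins e w v]].
  by exists e, w, v.
have clW : closed (adjacent_mod W T) (mem W).
  move=> x y /orP[/andP[Wx Wy] | /existsP[e /andP[Te e_xy]]].
    by rewrite Wx Wy.
  apply/idP/idP => [Wx | Wy]; apply: contraNT noX => nW; apply/existsP;
    exists e; apply/existsP.
    by exists x; apply/existsP; exists y; rewrite Te Wx nW.
  by exists y; apply/existsP; exists x; rewrite Te Wy nW joins_sym.
by have := closed_connect clW (cT w0 v0); rewrite Ww0 (negPf Wv0).
Qed.

(** W absorbs the other vertices one by one along crossing edges, each costing one edge; those edges
    form a spanning tree of G/W. *)
Lemma connected_mod_sub (G : multigraph) (W : {set vertex G}) (T : {set edge
  G}) :
  W != set0 -> connected_mod W T ->
  exists T' : {set edge G}, [/\ T' \subset T, connected_mod W T' & #|T'| = #|~: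
    W|].
Proof.
move: {-1}#|~: W| (erefl #|~: W|) => n; elim: n W T => [|n IHn] W T cardW W0 cT.
  move/cards0_eq: cardW => /(congr1 (@setC _)); rewrite setCK setC0 => defW.
  exists set0; rewrite sub0set cards0; split=> //; apply/connected_modP => u v.
  by apply: connect1; rewrite /adjacent_mod defW !inE.
have WnT : W != setT by apply: contra_eq_neq cardW => ->; rewrite setCT cards0.
have [e [w [v [Te Ww Wv e_wv]]]] := connected_mod_crossing W0 WnT cT.
have [|||T' [sT'T cT' cardT']] := IHn (v |: W) (T :\ e).
- by rewrite setCU setIC -setDE; move: cardW; rewrite (cardsD1 v (~: W)) inE Wv
  => -[].
- by apply/set0Pn; exists v; rewrite setU11.
- by rewrite -(connected_mod_edge Ww Te e_wv).
have eT' : e \notin T' by apply/negP => /(subsetP sT'T); rewrite !inE eqxx.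
exists (e |: T'); split; last by rewrite cardsU1 eT' cardT'.
  by rewrite subUset sub1set Te (subset_trans sT'T) // subD1set.
by rewrite (connected_mod_edge Ww (setU11 _ _) e_wv) setU1K.
Qed.

Lemma leq_card_connected_mod (G : multigraph) (W : {set vertex G}) (T : {set
  edge G}) :
  W != set0 -> connected_mod W T -> (#|~: W| <= #|T|)%N.
Proof.
by move=> W0 /(connected_mod_sub W0)[T' [sT'T _ <-]]; apply: subset_leq_card.
Qed.

(** An edge inside W could be dropped without disconnecting G/W, leaving fewer edges than
    [leq_card_connected_mod] allows. *)
Lemma connected_mod_tree_edge (G : multigraph) (W : {set vertex G}) (T : {set
  edge G}) e :
  W != set0 -> connected_mod W T -> #|T| = #|~: W| -> e \in T ->
  ~~ ((src e \in W) && (tgt e \in W)).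
Proof.
move=> W0 cT cardT Te; apply/negP => /andP[Ws Wt].
suff /(leq_card_connected_mod W0) : connected_mod W (T :\ e).
  by rewrite -cardT (cardsD1 e T) Te ltnn.
apply/connected_modP => u v; move/connected_modP: cT => /(_ u v).
apply: connect_sub => a b /orP[Wab | /existsP[f /andP[Tf f_ab]]];
  apply: connect1.
  by rewrite /adjacent_mod Wab.
have [def_f | ne_f] := eqVneq f e.
  rewrite def_f in f_ab; apply/orP; left.
  by have [] := joinsP (joins_src_tgt e) f_ab => -[-> ->]; apply/andP.
by apply/orP; right; apply: (adjacent_edge _ f_ab); rewrite !inE ne_f.
Qed.

Lemma connect_adjacent_mod1 (G : multigraph) (r : vertex G) (T : {set edge G}) :
  connect (adjacent_mod [set r] T) =2 connect (adjacent T).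
Proof.
move=> x y; apply/idP/idP; apply: connect_sub => a b.
  by rewrite /adjacent_mod !inE => /orP[/andP[/eqP-> /eqP->] // | /connect1].
by move=> ab; apply: connect1; rewrite /adjacent_mod ab orbT.
Qed.

Lemma spans_connected_mod1 (G : multigraph) (r : vertex G) (T : {set edge G}) :
  spans_connected T = connected_mod [set r] T.
Proof.
have -> : spans_connected T = [forall u, forall v, connect (adjacent T) u v].
  by rewrite /spans_connected; case: card_gt0P => // -[]; exists r.
by apply: eq_forallb => u; apply: eq_forallb => v;
  rewrite connect_adjacent_mod1.
Qed.

Lemma walk_connect (G : multigraph) (S : {set edge G}) (x y : vertex G * edge
  G) p :
  path (fun a b => joins a.2 a.1 b.1) x (rcons p y) ->
  {subset unzip2 (x :: p) <= S} -> connect (adjacent S) x.1 y.1.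
Proof.
elim: p x => [|z p IHp] x /=.
  rewrite andbT => xy sub; apply/connect1/adjacent_edge/xy.
  by apply: sub; rewrite inE.
move=> /andP[xz pz] sub; apply: (@connect_trans _ _ z.1); last first.
  by apply: IHp => // e ep; apply: sub; rewrite inE ep orbT.
by apply/connect1/adjacent_edge/xz; apply: sub; rewrite inE eqxx.
Qed.

(** The rest of the cycle is a detour around its first edge. *)
Lemma graph_cycle_edge (G : multigraph) (T : {set edge G}) c :
  graph_cycle c -> {subset unzip2 c <= T} ->
  exists2 e, e \in T & connect (adjacent T) =2 connect (adjacent (T :\ e)).
Proof.
case/and4P; case: c => // -[v0 e0] p _ /= cyc _ /andP[e0_p _] sub.
have Te0 : e0 \in T by apply: sub; rewrite inE eqxx.
exists e0 => // x y; apply/idP/idP; apply: connect_sub => a b; last first.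
  case/existsP=> f /andP[]; rewrite !inE => /andP[_ Tf] f_ab.
  by apply/connect1/adjacent_edge/f_ab.
case/existsP=> f /andP[Tf f_ab].
have [def_f | ne_f] := eqVneq f e0; last first.
  by apply/connect1/adjacent_edge/f_ab; rewrite !inE ne_f.
have [v1 e0_01 c10] : exists2 v1, joins e0 v0 v1 & connect (adjacent (T :\ e0))
  v1 v0.
  case: p cyc sub e0_p => [|[v1 e1] p] /=; first by rewrite andbT => e0_00;
    exists v0.
  move=> /andP[e0_01 pth] sub e0_p; exists v1 => //.
  apply: (walk_connect pth) => e ep; rewrite !inE sub ?andbT; last first.
    by rewrite inE; apply/orP; right.
  by apply: contraNneq e0_p => <-.
rewrite def_f in f_ab.
by have [] := joinsP e0_01 f_ab => -[-> ->] //; rewrite connect_adjacent_sym.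
Qed.

(** Chooses edges along a simple path, in the encoding of [graph_cycle]. The fourth clause makes the
    edges distinct; the last one lets a further edge close the cycle, and its final [e] is never
    read. *)
Lemma path_walk (G : multigraph) (S : {set edge G}) (v : vertex G) p :
  path (adjacent S) v p -> uniq (v :: p) ->
  exists c : seq (vertex G * edge G),
    [/\ unzip1 c = belast v p, {subset unzip2 c <= S}, uniq (unzip2 c),
        (forall e, e \in unzip2 c -> (src e \in v :: p) && (tgt e \in v :: p))
      & forall x e, joins x.2 x.1 v ->
          path (fun a b => joins a.2 a.1 b.1) x (rcons c (last v p, e))].
Proof.
elim: p v => [|w p IHp] v; first by exists [::]; split=> //= x e ->.
rewrite [path _ _ _]/= => /andP[/existsP[f /andP[Sf f_vw]] pw] uniq_vwp.
have /andP[v_wp uniq_wp] := uniq_vwp.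
have [c [c1 c2 c3 c4 c5]] := IHp w pw uniq_wp.
exists ((v, f) :: c); split=> [|e||e|x e x_v].
- by rewrite /= c1.
- by rewrite inE => /orP[/eqP-> | /c2].
- rewrite /= c3 andbT; apply: contra v_wp => /c4 /andP[].
  by have [] := joinsP (joins_src_tgt f) f_vw => -[-> _].
- rewrite inE => /orP[/eqP-> | /c4 /andP[s t]].
    by have [] := joinsP f_vw (joins_src_tgt f) => -[-> ->];
      rewrite !inE !eqxx !orbT.
  by rewrite inE s inE t !orbT.
by rewrite /= x_v; apply: c5.
Qed.

Lemma acyclic_edge (G : multigraph) (S T : {set edge G}) e :
  acyclic T -> S \subset T -> e \in T -> e \notin S ->
  ~~ connect (adjacent S) (tgt e) (src e).
Proof.
move/acyclicP => acT sST Te Se; apply/negP => /connectP[p0 p0P].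
case/shortenP: p0P => p pP uniq_p _ last_p.
have [c [c1 c2 c3 _ c5]] := path_walk pP uniq_p.
apply: (acT ((src e, e) :: c)); last first.
  by move=> f; rewrite inE => /orP[/eqP-> | /c2 /(subsetP sST)].
apply/and4P; split=> //.
- by rewrite /= [X in rcons _ (X, _)]last_p; apply/c5/joins_src_tgt.
- rewrite /= c1 last_p -rcons_uniq -lastI.
  by [].
by rewrite /= c3 andbT; apply: contra Se => /c2.
Qed.

(** A connected T contains a connected T' with |V| - 1 edges, and an edge of T outside T' would
    close a cycle. Conversely, a cycle would allow an edge to be removed below the minimal
    number. *)
Lemma spanning_treeE (G : multigraph) (T : {set edge G}) :
  spanning_tree T = spans_connected T && (#|T| == #|vertex G|.-1).
Proof.
rewrite /spanning_tree; case: (boolP (spans_connected T)) => // cT.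
have /card_gt0P[r _] : (0 < #|vertex G|)%N by case/andP: cT.
have r0 : [set r] != set0 by apply/set0Pn; exists r; rewrite inE.
have cardC : #|~: [set r]| = #|vertex G|.-1 by rewrite cardsC1.
rewrite (spans_connected_mod1 r) in cT.
apply/idP/eqP => [acT | cardT].
  have [T' [sT'T cT' cardT']] := connected_mod_sub r0 cT.
  rewrite -cardC -cardT'; congr #|pred_of_set _|; apply/eqP;
    rewrite eqEsubset sT'T andbT.
  apply/subsetP => e Te; apply: contraT => eT'.
  have := acyclic_edge acT sT'T Te eT'.
  by rewrite -(connect_adjacent_mod1 r); move/connected_modP: cT' => ->.
apply/acyclicP => c cyc /(graph_cycle_edge cyc)[e Te eqc].
have : connected_mod [set r] (T :\ e).
  by rewrite -(eq_connected_mod (W := [set r]) (T := T)) // => x y;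
    rewrite !connect_adjacent_mod1.
by move/(leq_card_connected_mod r0); rewrite cardC -cardT (cardsD1 e T) Te ltnn.
Qed.

(** The spanning tree sum of G/W, with trees recognized by their number of edges; the set [S] of
    available edges serves the induction by deletion and contraction. *)
Definition tree_poly (R : comNzRingType) (G : multigraph) (alpha : edge G -> R)
    (W : {set vertex G}) (S : {set edge G}) : R :=
  \sum_(T : {set edge G} | [&& T \subset S, connected_mod W T & #|T| == #|~:
    W|])
     \prod_(e in T) alpha e.

Definition class_mod (G : multigraph) (W : {set vertex G}) (v : vertex G) :
  vertex (identify W) := insub v.

Lemma class_mod_eqP (G : multigraph) (W : {set vertex G}) u v :
  reflect (u = v \/ u \in W /\ v \in W) (class_mod W u == class_mod W v).
Proof.
apply: (iffP eqP) => [|[-> // | [Wu Wv]]]; rewrite /class_mod.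
  case: (boolP (u \in W)) => [Wu | Wu]; case: (boolP (v \in W)) => [Wv | Wv];
    first by right.
  - by rewrite insubF ?Wu // insubT.
  - by rewrite insubT insubF ?Wv.
  - by rewrite !insubT => -[->]; left.
by rewrite !insubF ?Wu ?Wv.
Qed.

Lemma class_mod_surj (G : multigraph) (W : {set vertex G}) (x : vertex
  (identify W)) :
  W != set0 -> exists v, class_mod W v = x.
Proof.
case/set0Pn=> w Ww; case: x => [x|]; last by exists w;
  rewrite /class_mod insubF ?Ww.
by exists (val x); rewrite /class_mod valK.
Qed.

(** Paths of G/W lift to G because vertices of one class are equal or both in W, hence adjacent
    modulo W. *)
Lemma connected_mod_identify (G : multigraph) (W : {set vertex G})
    (T : {set edge (identify W)}) : W != set0 ->
  spans_connected T = connected_mod W (val @: T).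
Proof.
move=> W0; have [w Ww] := set0Pn _ W0.
have -> : spans_connected T = [forall u, forall v, connect (adjacent T) u v].
  by rewrite /spans_connected; case: card_gt0P => // -[];
    exists (class_mod W w).
have joinsE (e : edge (identify W)) u v : joins (val e) u v ->
    joins e (class_mod W u) (class_mod W v).
  by rewrite /joins => /orP[] /andP[/eqP<- /eqP<-]; rewrite !eqxx ?orbT.
have lift (e : edge (identify W)) u v : e \in T ->
    joins e (class_mod W u) (class_mod W v) -> connect (adjacent_mod W (val @:
      T)) u v.
  move=> Te; have Te' : val e \in val @: T by apply: imset_f.
  have st : connect (adjacent_mod W (val @: T)) (src (val e)) (tgt (val e)).
    by apply: connect1; rewrite /adjacent_mod (adjacent_edge Te') ?orbT
      ?joins_src_tgt.
  have same a b : class_mod W a = class_mod W b -> connect (adjacent_mod W (val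
    @: T)) a b.
    by move/eqP/class_mod_eqP=> [-> // | [Wa Wb]]; apply: connect1;
      rewrite /adjacent_mod Wa Wb.
  rewrite /joins => /orP[] /andP[/eqP/same s /eqP/same t].
    by apply: connect_trans t; apply: connect_trans st; rewrite connect_mod_sym.
  apply: connect_trans s; rewrite connect_mod_sym.
  by apply: connect_trans st _.
apply/idP/connected_modP => [/forallP cT u v | cT]; last first.
  apply/forallP => x; apply/forallP => y.
  have [u <-] := class_mod_surj x W0; have [v <-] := class_mod_surj y W0.
  have /connectP[p pP ->] := cT u v.
  elim: p u pP => //= a p IHp u /andP[ua pa]; apply: connect_trans (IHp a pa).
  case/orP: ua => [/andP[Wu Wa] | /existsP[_ /andP[/imsetP[e Te ->] /joinsE
    e_ua]]].
    suff /eqP-> : class_mod W u == class_mod W a by apply: connect0.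
    by apply/class_mod_eqP; right.
  by apply: connect1; apply: adjacent_edge e_ua.
have /forallP/(_ (class_mod W v))/connectP[p pP] := cT (class_mod W u).
elim: p u pP => [|x p IHp] u /=.
  move=> _ /esym/eqP/class_mod_eqP[-> // | [Wu Wv]].
  by apply: connect1; rewrite /adjacent_mod Wu Wv.
have [a <-] := class_mod_surj x W0.
move=> /andP[/existsP[e /andP[Te /(lift _ _ _ Te) ua]] pP] /(IHp a pP).
exact: connect_trans.
Qed.

Lemma card_identify (G : multigraph) (W : {set vertex G}) :
  #|vertex (identify W)|.-1 = #|~: W|.
Proof.
by rewrite card_option card_sig; apply: eq_card => v; rewrite !inE.
Qed.

Lemma identify_tree_sumE (R : comNzRingType) (G : multigraph) (alpha : edge G
  -> R)
    (W : {set vertex G}) : W != set0 ->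
  identify_tree_sum alpha W = tree_poly alpha W setT.
Proof.
move=> W0; rewrite /identify_tree_sum /tree_sum /tree_poly.
pose H := identify W; pose f (T : {set edge H}) : {set edge G} := val @: T.
pose g (T : {set edge G}) : {set edge H} := val @^-1: T.
have fK T : g (f T) = T.
  by apply/setP => e; rewrite inE mem_imset //; apply: val_inj.
rewrite [RHS](reindex_onto f g) => [|T /and3P[_ cT /eqP cardT]]; last first.
  apply/setP => e; apply/imsetP/idP => [[e' ge' ->] | Te]; first by move: ge';
    rewrite inE.
  have e_out := connected_mod_tree_edge W0 cT cardT Te.
  by exists (Sub e e_out); rewrite ?SubK // inE SubK.
apply: eq_big => [T | T _].
  rewrite fK eqxx andbT subsetT spanning_treeE connected_mod_identify //.
  by rewrite card_identify /f card_imset //; apply: val_inj.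
by rewrite big_imset //= => a b _ _; apply: val_inj.
Qed.

(** Deletion and contraction: trees avoiding e, and trees containing e, which become trees for v |:
    W once e is removed. *)
Lemma tree_poly_edge (R : comNzRingType) (G : multigraph) (alpha : edge G -> R)
    (W : {set vertex G}) (S : {set edge G}) e w v :
  e \in S -> w \in W -> v \notin W -> joins e w v ->
  tree_poly alpha W S =
    tree_poly alpha W (S :\ e) + alpha e * tree_poly alpha (v |: W) (S :\ e).
Proof.
move=> Se Ww Wv e_wv; rewrite {1}/tree_poly (bigID (fun T : {set edge G} => e
  \notin T)) /=.
congr (_ + _).
  by apply: eq_bigl => T; rewrite subsetD1 -!andbA; congr (_ && _);
    rewrite [RHS]andbC -!andbA.
rewrite (reindex_onto (fun T : {set edge G} => e |: T) (fun T => T :\ e)) /=;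
  last first.
  by move=> T /andP[_]; rewrite negbK; apply: setD1K.
rewrite big_distrr; apply: eq_big => [T | T /andP[_ /eqP defT]] /=; last first.
  by rewrite big_setU1 // -defT !inE eqxx.
rewrite negbK setU11 andbT.
have [Te | Te] := boolP (e \in T).
  rewrite subsetD1 Te andbF; apply/negbTE; rewrite negb_and; apply/orP; right.
  by apply: contraTneq Te => <-; rewrite !inE eqxx.
rewrite setU1K // eqxx andbT subUset sub1set Se subsetD1 Te andbT.
rewrite (connected_mod_edge Ww (setU11 _ _) e_wv) setU1K // cardsU1 Te.
have -> : #|~: W| = #|~: (v |: W)|.+1.
  by rewrite (cardsD1 v) inE Wv setCU setIC -setDE.
by rewrite add1n eqSS.
Qed.

Lemma tree_poly_setT (R : comNzRingType) (G : multigraph) (alpha : edge G -> R)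
    (S : {set edge G}) : tree_poly alpha setT S = 1.
Proof.
rewrite /tree_poly (big_pred1 set0) => [|T]; first by rewrite big_set0.
rewrite setCT cards0 cards_eq0; rewrite /=; case: (eqVneq T set0) => [->|_];
  last by rewrite !andbF.
rewrite sub0set !andbT; apply/connected_modP => u v.
by apply: connect1; rewrite /adjacent_mod !inE.
Qed.

Lemma tree_poly_no_crossing (R : comNzRingType) (G : multigraph) (alpha : edge
  G -> R)
    (W : {set vertex G}) (S : {set edge G}) : W != set0 -> W != setT ->
  (forall e w v, e \in S -> w \in W -> v \notin W -> ~~ joins e w v) ->
  tree_poly alpha W S = 0.
Proof.
move=> W0 WnT noX; apply: big1 => T /and3P[sTS cT _].
have [e [w [v [Te Ww Wv e_wv]]]] := connected_mod_crossing W0 WnT cT.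
by have := noX e w v (subsetP sTS e Te) Ww Wv; rewrite e_wv.
Qed.

(** * The matrix-tree theorem *)

Lemma eq_cofactor (R : comNzRingType) n (A B : 'M[R]_n) i j :
  (forall k l, k != i -> l != j -> A k l = B k l) ->
  cofactor A i j = cofactor B i j.
Proof.
move=> eqAB; congr (_ * \det _); apply/matrixP => k l; rewrite !mxE.
by apply: eqAB; rewrite eq_sym neq_lift.
Qed.

Lemma det_add_diag (R : comNzRingType) n (A B : 'M[R]_n) i a :
  (forall k l, B k l = A k l + (if (k == i) && (l == i) then a else 0)) ->
  \det B = \det A + a * cofactor A i i.
Proof.
move=> defB; rewrite (expand_det_row B i) (expand_det_row A i).
rewrite (bigD1 i) //= [X in _ = X + _](bigD1 i) //= defB eqxx /= mulrDl.
have cofE j : cofactor B i j = cofactor A i j.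
  by apply: eq_cofactor => k l /negPf ki _; rewrite defB ki addr0.
rewrite cofE addrAC; congr (_ + _ + _).
by apply: eq_bigr => j /negPf ji; rewrite cofE defB ji andbF addr0.
Qed.

Lemma cofactor_principal_mx (R : comNzRingType) n (A : 'M[R]_n) (I : {set
  'I_n}) i :
  cofactor (principal_mx A I) i i = \det (principal_mx A (I :\ i)).
Proof.
rewrite (expand_det_row _ i) (bigD1 i) //= big1 ?addr0 => [|j /negPf ji].
  rewrite mxE !inE eqxx mul1r; apply: eq_cofactor => k l ki li.
  by rewrite !mxE !inE ki li.
by rewrite mxE !inE eqxx /= eq_sym ji mul0r.
Qed.

Definition boundary (R : nzRingType) (G : multigraph) (v : vertex G) (e : edge
  G) : R :=
  (v == tgt e)%:R - (v == src e)%:R.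

Definition laplacian (R : nzRingType) (G : multigraph) (alpha : edge G -> R)
    (S : {set edge G}) : 'M[R]_#|vertex G| :=
  \matrix_(i, j) \sum_(e in S)
    alpha e * boundary R (enum_val i) e * boundary R (enum_val j) e.

Definition outside (G : multigraph) (W : {set vertex G}) : {set 'I_#|vertex G|}
  :=
  [set i | enum_val i \notin W].

Lemma card_outside (G : multigraph) (W : {set vertex G}) :
  #|outside W| = (#|vertex G| - #|W|)%N.
Proof.
rewrite -[in RHS](setCK W) -cardsCs -(card_imset _ (@enum_val_inj _ (vertex
  G))); congr #|pred_of_set _|.
apply/setP => v; rewrite inE; apply/imsetP/idP => [[i] | Wv].
  by rewrite inE => Wi ->.
by exists (enum_rank v); rewrite ?inE enum_rankK.
Qed.

Lemma boundary_sqr (R : comNzRingType) (G : multigraph) (e : edge G) u v :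
  joins e u v -> u != v -> boundary R v e * boundary R v e = 1.
Proof.
rewrite /joins /boundary => /orP[] /andP[/eqP<- /eqP<-].
  by rewrite eq_sym eqxx => /negPf->; rewrite subr0 mulr1.
by rewrite eq_sym eqxx eq_sym => /negPf->; rewrite sub0r mulrNN mulr1.
Qed.

Lemma boundary_eq0 (R : nzRingType) (G : multigraph) (e : edge G) u v x :
  joins e u v -> x != u -> x != v -> boundary R x e = 0.
Proof.
by rewrite /joins /boundary => /orP[] /andP[/eqP<- /eqP<-] /negPf-> /negPf->;
  rewrite subrr.
Qed.

(** As w lies in W, the edge e enters the minor only through the diagonal entry at v, in which the
    determinant is affine. This is the recursion of [tree_poly_edge]. *)
Lemma det_laplacian_edge (R : comNzRingType) (G : multigraph) (alpha : edge G
  -> R)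
    (W : {set vertex G}) (S : {set edge G}) e w v :
  e \in S -> w \in W -> v \notin W -> joins e w v ->
  \det (principal_mx (laplacian alpha S) (outside W)) =
    \det (principal_mx (laplacian alpha (S :\ e)) (outside W)) +
    alpha e * \det (principal_mx (laplacian alpha (S :\ e)) (outside (v |: W))).
Proof.
move=> Se Ww Wv e_wv.
have -> : outside (v |: W) = outside W :\ enum_rank v.
  apply/setP => i; rewrite !inE negb_or; congr (~~ _ && _).
  by rewrite -(inj_eq enum_rank_inj) enum_valK.
rewrite -cofactor_principal_mx; apply: det_add_diag => k l.
have rankE i : (i == enum_rank v) = (enum_val i == v).
  by rewrite -(inj_eq enum_rank_inj) enum_valK.
have wv : w != v by apply: contraNneq Wv => <-.
rewrite !mxE !inE; case: ifP => [/andP[Wk Wl] | nW]; last first.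
  case: ifP => [/andP[/eqP kv /eqP lv] | _]; last by rewrite addr0.
  by move: nW; rewrite kv lv !enum_rankK Wv.
rewrite (big_setD1 e) //= addrC !rankE; congr (_ + _).
have nz (i : 'I_#|vertex G|) : enum_val i \notin W -> enum_val i != v ->
  boundary R (enum_val i) e = 0.
  by move=> Wi iv; apply: (boundary_eq0 _ e_wv) => //;
    apply: contraNneq Wi => ->.
have [kv | kv] := eqVneq (enum_val k) v; last by rewrite (nz k) // mulr0 mul0r.
have [lv | lv] := eqVneq (enum_val l) v; last by rewrite (nz l) // mulr0.
by rewrite kv lv -mulrA (boundary_sqr _ e_wv) ?mulr1.
Qed.

(** The indicator vector of the complement of W is in the kernel: it is constant along every edge of
    S. *)
Lemma det_laplacian_no_crossing (F : fieldType) (G : multigraph) (alpha : edge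
  G -> F)
    (W : {set vertex G}) (S : {set edge G}) : W != setT ->
  (forall e w v, e \in S -> w \in W -> v \notin W -> ~~ joins e w v) ->
  \det (principal_mx (laplacian alpha S) (outside W)) = 0.
Proof.
move=> WnT noX.
have [v Wv] : exists v, v \notin W.
  by apply/existsP; apply: contraNT WnT => /existsPn allW; apply/eqP/setP => v;
     rewrite inE; apply/negPn/allW.
apply/eqP/det0P; exists (\row_i (enum_val i \notin W)%:R).
  apply/eqP => /rowP/(_ (enum_rank v)) /eqP.
  by rewrite !mxE enum_rankK Wv oner_eq0.
have bd0 e : e \in S ->
      \sum_(i < #|vertex G|) (enum_val i \notin W)%:R * boundary F (enum_val i)
        e = 0.
  move=> Se; have sumE x : \sum_(i < #|vertex G|) (enum_val i \notin W)%:R *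
    (enum_val i == x)%:R
      = (x \notin W)%:R :> F.
    rewrite (bigD1 (enum_rank x)) //= enum_rankK eqxx mulr1 big1 ?addr0 // => i
      ix.
    by rewrite -(inj_eq enum_rank_inj) enum_valK (negPf ix) mulr0.
  rewrite (eq_bigr (fun i : 'I_#|vertex G| => (enum_val i \notin W)%:R *
    (enum_val i == tgt e)%:R
    - (enum_val i \notin W)%:R * (enum_val i == src e)%:R)) => [|i _];
      last by rewrite mulrBr.
  rewrite sumrB !sumE.
  have := noX e (src e) (tgt e) Se; have := noX e (tgt e) (src e) Se.
  rewrite joins_sym joins_src_tgt.
  by case: (src e \in W); case: (tgt e \in W) => //= h1 h2; rewrite ?subrr //;
     by [have := h1 isT isT | have := h2 isT isT].
apply/rowP => j; rewrite !mxE.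
have [Wj | Wj] := boolP (enum_val j \in W).
  rewrite big1 // => i _; rewrite !mxE !inE Wj andbF.
  by case: eqVneq => [-> | _]; rewrite ?Wj ?mul0r ?mulr0.
transitivity (\sum_(i < #|vertex G|) \sum_(e in S)
   (enum_val i \notin W)%:R * (alpha e * boundary F (enum_val i) e * boundary F
     (enum_val j) e)).
  apply: eq_bigr => i _; rewrite !mxE !inE Wj andbT.
  case: (enum_val i \in W) => /=; first by rewrite mul0r big1 // => e _;
    rewrite mul0r.
  by rewrite mul1r; apply: eq_bigr => e _; rewrite mul1r.
rewrite exchange_big big1 //= => e Se.
transitivity (alpha e * boundary F (enum_val j) e *
    \sum_(i < #|vertex G|) (enum_val i \notin W)%:R * boundary F (enum_val i)
      e).
  by rewrite mulr_sumr; apply: eq_bigr => i _; ring.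
by rewrite bd0 // mulr0.
Qed.

(** The matrix-tree theorem for G/W: both sides obey the same recursion on crossing edges, are 1
    when W is everything, and are 0 when no edge crosses out of a smaller W. *)
Lemma det_laplacian (F : fieldType) (G : multigraph) (alpha : edge G -> F)
    (W : {set vertex G}) (S : {set edge G}) : W != set0 ->
  \det (principal_mx (laplacian alpha S) (outside W)) = tree_poly alpha W S.
Proof.
move: {2}#|S| (leqnn #|S|) => n; elim: n W S => [|n IHn] W S leSn W0.
all: have [WT | WnT] := eqVneq W setT; first
  (rewrite WT tree_poly_setT -[RHS](det1 _ #|vertex G|); congr (\det _);
   apply/matrixP => i j; by rewrite !mxE !inE).
  move: leSn; rewrite leqn0 cards_eq0 => /eqP->.
  by rewrite det_laplacian_no_crossing ?tree_poly_no_crossing // => e w v;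
    rewrite inE.
have [/existsP[e /existsP[w /existsP[v /and4P[Se Ww Wv e_wv]]]] | noX] :=
    boolP [exists e, exists w, exists v, [&& e \in S, w \in W, v \notin W &
      joins e w v]].
  have leSen : (#|S :\ e| <= n)%N by rewrite (cardsD1 e S) Se in leSn.
  rewrite (det_laplacian_edge _ Se Ww Wv e_wv) (tree_poly_edge _ Se Ww Wv e_wv).
  rewrite !IHn //; apply/set0Pn; exists v; exact: setU11.
have noXP e w v : e \in S -> w \in W -> v \notin W -> ~~ joins e w v.
  move=> Se Ww Wv; apply: contra noX => e_wv; apply/existsP; exists e.
  by apply/existsP; exists w; apply/existsP; exists v; rewrite Se Ww Wv.
by rewrite det_laplacian_no_crossing ?tree_poly_no_crossing.
Qed.

(** * Flows *)

Definition potential_diff (R : nzRingType) (G : multigraph)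
    (x : 'rV[R]_#|vertex G|) (e : edge G) : R :=
  \sum_i x 0 i * boundary R (enum_val i) e.

Lemma qform_laplacian (R : comNzRingType) (G : multigraph) (alpha : edge G ->
  R) x :
  qform (laplacian alpha setT) x = \sum_e alpha e * potential_diff x e ^+ 2.
Proof.
have lapE i j : laplacian alpha setT i j =
    \sum_e alpha e * boundary R (enum_val i) e * boundary R (enum_val j) e.
  by rewrite mxE; apply: eq_bigl => e; rewrite inE.
rewrite /qform mxE.
under eq_bigr do (rewrite !mxE mulr_suml;
  under eq_bigr do rewrite lapE mulr_sumr mulr_suml).
under eq_bigr do rewrite exchange_big /=.
rewrite exchange_big /=; apply: eq_bigr => e _.
rewrite expr2 /potential_diff big_distrlr /= mulr_sumr; apply: eq_bigr => j _.
by rewrite mulr_sumr; apply: eq_bigr => i _; ring.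
Qed.

Lemma is_flowE (R : comNzRingType) (G : multigraph) (k : {ffun edge G -> R}) :
  is_flow k = [forall i : 'I_#|vertex G|, \sum_e k e * boundary R (enum_val i)
    e == 0].
Proof.
have incE v e : k e *~ incidence v e = k e * boundary R v e.
  rewrite /incidence /boundary; case: eqVneq => [-> | st];
    first by rewrite subrr mulr0.
  case: (eqVneq v (src e)) => [-> | _]; first by rewrite (negPf st) sub0r
    mulrN1.
  by case: eqVneq => _; rewrite subr0 ?mulr1 ?mulr0.
apply/forallP/forallP => fl i.
  by have := fl (enum_val i); under eq_bigr do rewrite incE.
have /eqP := fl (enum_rank i); rewrite enum_rankK => fli.
by apply/eqP; rewrite -[RHS]fli; apply: eq_bigr => e _; apply: incE.
Qed.

Lemma sum_zero_excess_linear (F : finFieldType) n (c : 'I_n -> F) i : c i != 0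
  ->
  \sum_(x : 'rV_n) zero_excess (\sum_j x 0 j * c j) = 0.
Proof.
move=> ci0; pose S := \sum_(x : 'rV_n) zero_excess (\sum_j x 0 j * c j).
(* S is taken once for each shift of coordinate i by t; for fixed x, the sum over t is that of an
   affine function. *)
suff : \sum_(t : F) S = 0.
  rewrite sumr_const => /eqP; rewrite mulrn_eq0 => /orP[|/eqP //].
  by rewrite cardT -cardE; have := finNzRing_gt1 F; case: #|F|.
rewrite (eq_bigr (fun t => \sum_(x : 'rV_n)
    zero_excess (\sum_j x 0 j * c j + c i * t))) => [|t _].
  by rewrite exchange_big big1 //= => x _; apply: sum_zero_excess_affine.
rewrite [LHS](reindex (fun x => x + t *: delta_mx 0 i)) /=; last first.
  by exists (fun x => x - t *: delta_mx 0 i) => x _; rewrite ?addrK ?subrK.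
apply: eq_bigr => x _; congr zero_excess.
under eq_bigr do rewrite !mxE mulrDl; rewrite big_split /=; congr (_ + _).
rewrite (bigD1 i) //= !eqxx mulr1 big1 ?addr0 1?mulrC // => j /negPf ji.
by rewrite ji mulr0 mul0r.
Qed.

(** Summation by parts gives a linear form in x whose coefficients are the net flows of k at the
    vertices. *)
Lemma sum_zero_excess_flow (F : finFieldType) (G : multigraph) (k : {ffun edge
  G -> F}) :
  \sum_x zero_excess (\sum_e k e * potential_diff x e) =
    #|F|%:Z ^+ #|vertex G| * (#|F|%:Z - 1) * (is_flow k)%:Z.
Proof.
have swap x : \sum_e k e * potential_diff x e =
    \sum_i x 0 i * \sum_e k e * boundary F (enum_val i) e.
  rewrite /potential_diff; under eq_bigr do rewrite mulr_sumr.
  rewrite exchange_big; apply: eq_bigr => i _; rewrite mulr_sumr.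
  by apply: eq_bigr => e _; rewrite mulrCA.
under eq_bigr do rewrite swap.
rewrite is_flowE; case: forallP => [fl | /forallP]; last first.
  rewrite negb_forall mulr0 => /existsP[i ci].
  exact: (sum_zero_excess_linear (c := fun i => \sum_e k e * boundary F
    (enum_val i) e) ci).
rewrite (eq_bigr (fun=> #|F|%:Z - 1)) => [|x _]; last first.
  by rewrite big1 ?zero_excess0 // => i _; rewrite (eqP (fl i)) mulr0.
rewrite sumr_const cardT -cardE card_mx mul1n mulr1.
by rewrite -mulr_natl natrX natz.
Qed.

Lemma sum_nowhere_zero_rescale (F : finFieldType) (E : finType) (u : E -> F)
    (f : {ffun E -> F} -> int) : (forall e, u e != 0) ->
  \sum_(k : {ffun E -> F} | nowhere_zero k) f k =
  \sum_(k : {ffun E -> F} | nowhere_zero k) f [ffun e => k e * u e].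
Proof.
move=> u0; rewrite (reindex (fun k : {ffun E -> F} => [ffun e => k e * u e]))
  /=.
  apply: eq_bigl => k; apply: eq_forallb => e.
  by rewrite ffunE mulf_eq0 (negPf (u0 e)) orbF.
exists (fun k : {ffun E -> F} => [ffun e => k e / u e]) => k _.
  by apply/ffunP => e; rewrite !ffunE mulfK.
by apply/ffunP => e; rewrite !ffunE mulfVK.
Qed.

Lemma flow_number_excess (F : finFieldType) (G : multigraph) :
  #|F|%:Z ^+ #|vertex G| * (#|F|%:Z - 1) * (flow_number F G)%:Z =
  \sum_(alpha : {ffun edge G -> F} | nowhere_zero alpha)
     \sum_x zero_excess (qform (laplacian alpha setT) x).
Proof.
transitivity (\sum_(k : {ffun edge G -> F} | nowhere_zero k)
    \sum_x zero_excess (\sum_e k e * potential_diff x e)).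
  under [RHS]eq_bigr do rewrite sum_zero_excess_flow.
  rewrite -mulr_sumr /flow_number -sum1_card (big_morph _ PoszD (erefl 0%:Z));
    congr (_ * _).
  rewrite [RHS]big_mkcond [LHS]big_mkcond /=; apply: eq_bigr => k _.
  by rewrite inE; case: nowhere_zero; case: is_flow.
rewrite exchange_big [RHS]exchange_big /=; apply: eq_bigr => x _.
(* The value 1 keeps the rescaling invertible on edges without potential difference, where both
   terms are 0. *)
pose u e := if potential_diff x e == 0 then 1 else potential_diff x e.
have u0 e : u e != 0 by rewrite /u; case: (eqVneq (potential_diff x e) 0) =>
  [_|//]; apply: oner_neq0.
rewrite (sum_nowhere_zero_rescale _ u0); apply: eq_bigr => k _.
rewrite qform_laplacian; congr zero_excess; apply: eq_bigr => e _.
rewrite ffunE /u expr2 mulrA; case: eqVneq => [-> | _] //.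
by rewrite !mulr0.
Qed.

(** * The rank of the Laplacian, W* and the comparison of both sides *)

Lemma laplacian_sym (R : comNzRingType) (G : multigraph) (alpha : edge G -> R)
  S :
  (laplacian alpha S)^T = laplacian alpha S.
Proof. by apply/matrixP => i j; rewrite !mxE; apply: eq_bigr => e _; ring. Qed.

(** A smallest W leaves a largest nonzero principal minor outside it, and for a symmetric matrix the
    order of the latter is the rank. *)
Lemma Wstar_rank (F : finFieldType) (G : multigraph) (alpha : edge G -> F) W :
  is_Wstar alpha W ->
  let L := laplacian alpha setT in
  [/\ \rank L = (#|vertex G| - #|W|)%N, #|outside W| = \rank L
    & \det (principal_mx L (outside W)) = identify_tree_sum alpha W].
Proof.
case=> W0 sW minW L.
have detW : \det (principal_mx L (outside W)) = identify_tree_sum alpha W.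
  by rewrite det_laplacian // identify_tree_sumE.
suff rW : #|outside W| = \rank L by split=> //; rewrite -rW card_outside.
apply/eqP; rewrite eqn_leq leq_principal_rank ?detW //=.
have [I <- detI] := principal_rank_exists (laplacian_sym alpha setT).
pose W' : {set vertex G} := [set v | enum_rank v \notin I].
have def_I : I = outside W' by apply/setP => i; rewrite !inE negbK enum_valK.
(* The whole Laplacian is singular, so I omits some index. *)
have W'0 : W' != set0.
  apply: contraNneq detI => W'0; rewrite def_I W'0 det_laplacian_no_crossing //.
    by have [w Ww] := set0Pn _ W0; apply/eqP => /setP/(_ w); rewrite !inE.
  by move=> e w v _; rewrite inE.
have := minW W' W'0; rewrite identify_tree_sumE // -det_laplacian // -def_I =>
  /(_ detI).
by rewrite def_I !card_outside => /leq_sub2l; apply.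
Qed.

Lemma det_principal_scale (R : comNzRingType) n (A : 'M[R]_n) (I : {set 'I_n})
  c :
  \det (principal_mx (c *: A) I) = c ^+ #|I| * \det (principal_mx A I).
Proof. by rewrite !principal_mx_enum -scalemxAr -scalemxAl detZ. Qed.

Lemma laplacian_scale (R : comNzRingType) (G : multigraph) (alpha : edge G ->
  R) S c :
  laplacian (fun e => alpha e * c) S = c *: laplacian alpha S.
Proof.
by apply/matrixP => i j; rewrite !mxE mulr_sumr; apply: eq_bigr => e _; ring.
Qed.

Lemma expn_mod4 p d : (p %% 4 = 3)%N -> (p ^ d %% 4 = if odd d then 3 else 1)%N.
Proof.
move=> p3; elim: d => // d IHd.
by rewrite expnS -modnMm p3 IHd /=; case: (odd d).
Qed.

(** Squaring removes the sign; what remains is to compare 1 or (-1)^d with the parity of (q - 1)/2,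
    read off from q modulo 4. *)
Lemma gauss_sum_sqr (C : numClosedFieldType) (F : finFieldType) p d :
  odd p -> #|F| = (p ^ d)%N ->
  gauss_sum C p d ^+ 2 = (quadratic_char (-1 : F))%:~R * (p ^ d)%:R.
Proof.
move=> odd_p cardF; have oddF : odd #|F| by rewrite cardF oddX odd_p orbT.
rewrite quadratic_charN1 // cardF /gauss_sum.
have [p1 | p3] : (p %% 4 = 1 \/ p %% 4 = 3)%N by lia.
  rewrite p1 eqxx exprMn sqrtCK -exprM mulnC exprM sqrrN expr1n expr1n mul1r.
  have : (p ^ d %% 4 = 1)%N by rewrite -modnXm p1 exp1n.
  move=> q1; rewrite -signr_odd.
  have -> : odd (p ^ d).-1./2 = false by lia.
  by rewrite expr0 mul1r.
rewrite p3 /= !exprMn sqrtCK -exprM mulnC exprM sqrrN expr1n expr1n mul1r.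
rewrite -exprM mulnC exprM sqrCi; congr (_ * _).
rewrite rmorphXn rmorphN1 -[LHS]signr_odd -[RHS]signr_odd;
  congr (_ ^+ (nat_of_bool _)).
by have := expn_mod4 d p3; case: (odd d); lia.
Qed.

(** For r = 2m, (g/q)^r = (eta(-1)/q)^m, which supplies both the sign eta((-1)^m) and the factor
    q^-m of the count. *)
Lemma Wstar_term_even (C : numClosedFieldType) (F : finFieldType) p d
    (G : multigraph) (alpha : edge G -> F) W :
  odd p -> #|F| = (p ^ d)%N -> is_Wstar alpha W ->
  let L := laplacian alpha setT in ~~ odd (\rank L) ->
  (#|F|%:Z ^+ #|vertex G| * (#|F|%:Z - 1))%:~R *
     ((quadratic_char (identify_tree_sum alpha W))%:~R *
       (gauss_sum C p d / (p ^ d)%:R) ^+ (#|vertex G| - #|W|)) =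
    (\sum_x zero_excess (qform L x))%:~R.
Proof.
move=> odd_p cardF Wst L even_r.
have oddF : odd #|F| by rewrite cardF oddX odd_p orbT.
have [rL rI detI] := Wstar_rank Wst.
have detI0 : \det (principal_mx L (outside W)) != 0 by rewrite detI; case: Wst.
pose m := (\rank L)./2.
have r2m : \rank L = m.*2 by rewrite -[LHS]odd_double_half (negPf even_r).
have := sum_zero_excess_qform_even oddF (laplacian_sym alpha setT) rI detI0 r2m.
rewrite -/L detI quadratic_charM // quadratic_charX // => sumE.
have := gauss_sum_sqr C odd_p cardF.
have : (p ^ d)%:R = #|F|%:Z%:~R :> C by rewrite cardF.
set q : C := _%:R => def_q gauss2.
have q_neq0 : q != 0.
  by rewrite def_q intr_eq0; have := finNzRing_gt1 F; case: #|F|.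
have qm_neq0 : q ^+ m != 0 by rewrite expf_neq0.
have castE k : (#|F|%:Z ^+ k)%:~R = q ^+ k by rewrite rmorphXn /= -def_q.
apply: (mulfI qm_neq0); rewrite -castE -[RHS]rmorphM sumE -rL r2m -mul2n exprM.
rewrite expr_div_n gauss2 !rmorphM !rmorphXn /= -!def_q.
have -> : (quadratic_char (-1 : F))%:~R * q / q ^+ 2 =
    (quadratic_char (-1 : F))%:~R / q by field.
by rewrite expr_div_n; field.
Qed.

(** Scaling alpha by a nonsquare c permutes the terms and multiplies minors of odd order r by c^r,
    of character -1. The choice [Wstar] may change under scaling, but [max_principal_char] makes the
    character independent of it. Hence S = - S. *)
Lemma sum_Wstar_odd (C : numClosedFieldType) (F : finFieldType) (G : multigraph)
    (Wstar : {ffun edge G -> F} -> {set vertex G}) (gamma : C) :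
  odd #|F| ->
  (forall alpha : {ffun edge G -> F}, nowhere_zero alpha -> is_Wstar alpha
    (Wstar alpha)) ->
  \sum_(alpha : {ffun edge G -> F} |
          nowhere_zero alpha && odd (\rank (laplacian alpha setT)))
     (quadratic_char (identify_tree_sum alpha (Wstar alpha)))%:~R *
       gamma ^+ (#|vertex G| - #|Wstar alpha|) = 0.
Proof.
move=> oddF WstarP; set S := (X in X = 0).
have [c nsq_c] := nonsquare_exists oddF.
have c0 : c != 0 by apply: contra_eq_neq nsq_c => ->; rewrite quadratic_char0.
suff : S = - S.
  move/eqP; rewrite -addr_eq0 -mulr2n mulrn_eq0 => /eqP ->//.
pose sc (a : edge G -> F) : {ffun edge G -> F} := [ffun e => a e * c].
have nz_sc a : nowhere_zero (sc a) = [forall e, a e != 0].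
  by apply: eq_forallb => e; rewrite ffunE mulf_eq0 (negPf c0) orbF.
have lap_sc a : laplacian (sc a) setT = c *: laplacian a setT.
  rewrite -laplacian_scale; apply/matrixP => i j; rewrite !mxE.
  by apply: eq_bigr => e _; rewrite ffunE.
rewrite -sumrN {1}/S (reindex (fun a : {ffun edge G -> F} => sc a)) /=;
  last first.
  exists (fun a : {ffun edge G -> F} => [ffun e => a e / c]) => a _.
    by apply/ffunP => e; rewrite !ffunE mulfK.
  by apply/ffunP => e; rewrite !ffunE mulfVK.
apply: eq_big => a; first by rewrite nz_sc lap_sc mxrank_scale_nz.
rewrite nz_sc => /andP[nz_a]; rewrite lap_sc mxrank_scale_nz // => odd_r.
have [rL rI detI] := Wstar_rank (WstarP a nz_a).
have Wst' := WstarP (sc a) (etrans (nz_sc a) nz_a).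
have [] := Wstar_rank Wst'; rewrite lap_sc mxrank_scale_nz // => rL' rI' detI'.
rewrite -rL -rL' -detI -detI' -mulNr -rmorphN; congr (_%:~R * _).
have det0 : \det (principal_mx (laplacian a setT) (outside (Wstar a))) != 0.
  by rewrite detI; case: (WstarP a nz_a).
have det0' : \det (principal_mx (laplacian a setT) (outside (Wstar (sc a)))) !=
  0.
  have : identify_tree_sum (sc a) (Wstar (sc a)) != 0 by case: Wst'.
  by rewrite -detI' det_principal_scale; apply: contraNneq => ->; rewrite mulr0.
rewrite det_principal_scale quadratic_charM // quadratic_charX // nsq_c rI'.
rewrite (max_principal_char oddF (laplacian_sym a setT) rI' rI det0' det0).
by rewrite -signr_odd odd_r mulN1r.
Qed.

Theorem theorem1 (C : numClosedFieldType) (p d : nat)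
    (p_prime : prime p) (p_odd : odd p) (d_ge1 : (1 <= d)%N)
    (F : finFieldType) (cardF : #|F| = (p ^ d)%N)
    (G : multigraph) (G_conn : connected_graph G)
    (Wstar : {ffun edge G -> F} -> {set vertex G})
    (WstarP : forall alpha : {ffun edge G -> F},
       nowhere_zero alpha -> is_Wstar alpha (Wstar alpha)) :
  (flow_number F G)%:R =
    \sum_(alpha : {ffun edge G -> F} | nowhere_zero alpha)
      (quadratic_char (identify_tree_sum alpha (Wstar alpha)))%:~R
        * (gauss_sum C p d / (p ^ d)%:R)
            ^+ (#|vertex G| - #|Wstar alpha|) :> C.
Proof.
have oddF : odd #|F| by rewrite cardF oddX p_odd orbT.
have k_neq0 : (#|F|%:Z ^+ #|vertex G| * (#|F|%:Z - 1))%:~R != 0 :> C.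
  rewrite intr_eq0; have := finNzRing_gt1 F.
  by case: #|F| => [|[|q]] // _; rewrite mulf_neq0 ?expf_neq0 //; lia.
apply: (mulfI k_neq0); rewrite -[(flow_number F G)%:R]/((flow_number F
  G)%:Z%:~R).
rewrite -rmorphM flow_number_excess rmorph_sum.
rewrite (bigID (fun a : {ffun edge G -> F} => odd (\rank (laplacian a setT))))
  /=.
rewrite [in RHS](bigID (fun a : {ffun edge G -> F} => odd (\rank (laplacian a
  setT)))) /=.
(* In odd rank, the flow side vanishes term by term, whereas the other side vanishes only as a
   sum. *)
rewrite (sum_Wstar_odd _ oddF WstarP) add0r big1 ?add0r => [|a /andP[_ odd_r]];
  last first.
  by rewrite sum_zero_excess_qform_odd // laplacian_sym.
rewrite mulr_sumr; apply: eq_bigr => a /andP[nz_a even_r].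
by rewrite (Wstar_term_even C p_odd cardF (WstarP a nz_a)).
Qed.
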